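(* The approximate Newton algorithm described in the context (with its Armijo stepsize rule and scalars $\bar\alpha>0$, $\beta,\sigma\in(0,1)$), applied to the BFM manifold $\mathcal M_{\rm BFM}$ with the cost function $f_{\rm BFM}(\mathbf x)=\|\mathbf w-\bar{\mathbf w}\|_2^2$ and the retraction $\mathcal R^{\rm BFM}$, is a Riemannian approximate Newton method, with guaranteed descent (at each iteration) and local superlinear convergence rate.
   Context: Network. A radial distribution network is a tree rooted at the slack node $0$, with remaining nodes $\mathcal J=\{1,\dots,J\}$. For $j\in\mathcal J$, $i=i(j)$ is its parent (upstream node), line $j$ is the edge from $i(j)$ to $j$, and $\mathcal J'(j)=\{j'\in\mathcal J: i(j')=j\}$. Parameters: $r_j,x_j$ (series resistance and reactance), $a_j$ (transformer tap ratio), $G_j,B_j$ (shunt admittance $G_j-\sqrt{-1}\,B_j$), $v_0$ (fixed slack squared voltage magnitude), and known injections $\bar p_j,\bar q_j$. Variables: real and reactive flows $P_j,Q_j$ at the sending end of line $j$, squared current magnitudes $l_j$, squared voltage magnitudes $v_j$, net real and reactive injections $p_j,q_j$. The Branch Flow Model (BFM) equations are, for all $j\in\mathcal J$ and $i=i(j)$: $$\begin{aligned}&\textstyle\sum_{j'\in\mathcal J'(j)}P_{j'}-P_j+a_j^2r_jl_j+G_jv_j=p_j, &(R)\\ &\textstyle\sum_{j'\in\mathcal J'(j)}Q_{j'}-Q_j+a_j^2x_jl_j-B_jv_j=q_j, &(I)\\ &v_j=\tfrac{v_i}{a_j^2}-2(r_jP_j+x_jQ_j)+a_j^2(r_j^2+x_j^2)l_j,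 &(V)\\ &v_il_j=P_j^2+Q_j^2. &(C)\end{aligned}$$ Standing assumption: a feasible load flow solution exists, i.e. a solution of these equations with $p_j=\bar p_j$, $q_j=\bar q_j$ for all $j$ (so the minimum of $f_{\rm BFM}$ on the manifold is zero). Manifold and cost. Let $\mathbf u=(\mathbf P^T,\mathbf Q^T,\mathbf l^T,\mathbf v^T)^T\in\mathbb R^{4J}$, $\mathbf w=(\mathbf p^T,\mathbf q^T)^T\in\mathbb R^{2J}$, $\mathbf x=(\mathbf u^T,\mathbf w^T)^T\in\mathbb R^{6J}$, $\bar{\mathbf w}=(\bar{\mathbf p}^T,\bar{\mathbf q}^T)^T$. Writing (R), (I), (V), (C) for all $j$ as $\mathbf F_{\rm BFM}(\mathbf x)=\mathbf 0$, $\mathcal M_{\rm BFM}=\{\mathbf x\in\mathbb R^{6J}:\mathbf F_{\rm BFM}(\mathbf x)=\mathbf 0\}$, regarded as a smooth Riemannian manifold of the Euclidean space with the dot product as metric. For a manifold $\mathcal M$ given by $\mathbf h(\mathbf x)=\mathbf 0$, $\mathcal T_{\mathbf x}\mathcal M=\{\boldsymbol\xi:\mathrm D\mathbf h(\mathbf x)[\boldsymbol\xi]=\mathbf 0\}$, $\mathbf\Pi_{\mathbf x}$ is the orthogonal projection onto $\mathcal T_{\mathbf x}\mathcal M$, $\mathrm{grad} f(\mathbf x)=\mathbf\Pi_{\mathbf x}\nabla f(\mathbf x)$ is the Riemannian gradient ($\nabla f$ the Euclidean gradient), and $\mathrm{hess} f(\mathbf x)[\boldsymbol\xi]=\mathbf\Pi_{\mathbf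 x}\,\mathrm D\,\mathrm{grad} f(\mathbf x)[\boldsymbol\xi]$, for $\boldsymbol\xi\in\mathcal T_{\mathbf x}\mathcal M$, is the Riemannian Hessian. Retraction $\mathcal R^{\rm BFM}$. Given $\mathbf x\in\mathcal M_{\rm BFM}$ and $\boldsymbol\xi\in\mathcal T_{\mathbf x}\mathcal M_{\rm BFM}$, put $\tilde{\mathbf x}=\mathbf x+\boldsymbol\xi$, with components $\tilde P_j,\tilde Q_j,\dots$. Then $\mathcal R^{\rm BFM}_{\mathbf x}(\boldsymbol\xi)$ has components computed from the root towards the leaves, with $v_0^+=v_0$ and $i=i(j)$, by $$P_j^+=\tilde P_j,\quad Q_j^+=\tilde Q_j,\quad l_j^+=\frac{\tilde P_j^2+\tilde Q_j^2}{v_i^+},\quad v_j^+=\frac{v_i^+}{a_j^2}-2(r_j\tilde P_j+x_j\tilde Q_j)+a_j^2(r_j^2+x_j^2)l_j^+,$$ and $p_j^+,q_j^+$ obtained as the right-hand sides of (R), (I) using $P^+,Q^+,l^+,v^+$. Algorithm. Inputs: scalars $\bar\alpha>0$, $\beta,\sigma\in(0,1)$, and small $\epsilon>0$; output: a critical point $\mathbf x^*\in\mathcal M_{\rm BFM}$ of $f_{\rm BFM}$. Start at $\mathbf x_0\in\mathcal M_{\rm BFM}$. While $\|\mathrm{grad} f_{\rm BFM}(\mathbf x_k)\|_2>\epsilon$: find a direction $\boldsymbol\xi_k\in\mathcal T_{\mathbf x_k}\mathcal M_{\rm BFM}$ with $f_{\rm BFM}(\mathbf x_k+\boldsymbol\xi_k)=0$,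 i.e. $\boldsymbol\xi_k=(\boldsymbol\zeta_k^T,\boldsymbol\eta_k^T)^T$ ($\boldsymbol\zeta_k\in\mathbb R^{4J}$, $\boldsymbol\eta_k\in\mathbb R^{2J}$) solves the linear system $$\boldsymbol\xi_k\in\mathcal T_{\mathbf x_k}\mathcal M_{\rm BFM},\qquad \mathbf w_k+\boldsymbol\eta_k=\bar{\mathbf w};$$ then set $\mathbf x_{k+1}=\mathcal R^{\rm BFM}_{\mathbf x_k}(\beta^m\bar\alpha\boldsymbol\xi_k)$, where $m$ is the smallest nonnegative integer satisfying the Armijo rule $f_{\rm BFM}(\mathbf x_k)-f_{\rm BFM}(\mathcal R^{\rm BFM}_{\mathbf x_k}(\beta^m\bar\alpha\boldsymbol\xi_k))\ge-\sigma\langle\mathrm{grad} f_{\rm BFM}(\mathbf x_k),\beta^m\bar\alpha\boldsymbol\xi_k\rangle$; increase $k$ by 1. (Remark: if the rows of the linear system are linearly independent, its solution can be viewed as that of minimizing $f_{\rm BFM}(\mathbf x_k+\boldsymbol\xi)$ over $\boldsymbol\xi\in\mathcal T_{\mathbf x_k}\mathcal M_{\rm BFM}$.) Terminology. Riemannian approximate Newton method: the directions satisfy $[\mathrm{hess} f(\mathbf x_k)+\mathbf E_k]\boldsymbol\xi_k=-\mathrm{grad} f(\mathbf x_k)$, where the approximation error $\mathbf E_k$ has sufficiently small bounds to preserve superlinear convergence, namely $\|\mathbf E_k\|_2\le\gamma\|\mathrm{grad} f(\mathbf x_k)\|_2$ for some constant $\gamma$. Guaranteed descent: at every iterate that is not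 a load flow solution, $\langle\mathrm{grad} f(\mathbf x_k),\boldsymbol\xi_k\rangle<0$ and $f(\mathbf x_{k+1})<f(\mathbf x_k)$. Local superlinear convergence rate: the iterates of the algorithm (leaving the stopping test aside), started sufficiently close to the solution $\mathbf x^*$, converge to it superlinearly, $\|\mathbf x_{k+1}-\mathbf x^*\|/\|\mathbf x_k-\mathbf x^*\|\to0$ (unless $\mathbf x^*$ is reached exactly).
   Formalization: Uniform γ and local convergence assume nonzero parent voltages and independent rows of the linear system; the superlinear rate also needs σ<1/2, β^m·ᾱ=1 for some m and earlier trial steps >2(1−σ) (false otherwise, e.g. ᾱ=1/2); the start must have nonzero parent voltages. *)

(* Defs.v *)
From HB Require Import structures.
From mathcomp Require Import all_boot all_order all_algebra.
From mathcomp Require Import all_classical all_reals all_analysis.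

Set Implicit Arguments.
Unset Strict Implicit.
Unset Printing Implicit Defensive.
Import Order.TTheory GRing.Theory Num.Theory.
Import numFieldNormedType.Exports.
Local Open Scope classical_set_scope.
Local Open Scope ring_scope.

Section Riemannian.
Variable R : realType.

Definition dot n (u v : 'rV[R]_n) : R := \sum_i u 0 i * v 0 i.

(* The library norm [`|u|] on row vectors is the max norm, hence this one. *)
Definition norm2 n (u : 'rV[R]_n) : R := Num.sqrt (dot u u).

Definition euclidean_gradient n (f : 'rV[R]_n -> R) (x : 'rV[R]_n) : 'rV[R]_n :=
  \row_i 'D_(delta_mx 0 i) f x.

(* Projection onto the row space of U along its orthogonal complement
   [{w | w *m U^T = 0}]; it acts on row vectors by right multiplication. *)
Definition orth_proj p n (U : 'M[R]_(p, n)) : 'M[R]_n :=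
  proj_mx <<U>>%MS (kermx U^T).

Variables n m : nat.
Implicit Types (h : 'rV[R]_n -> 'rV[R]_m) (f : 'rV[R]_n -> R).
Implicit Types x xi : 'rV[R]_n.

Definition level_manifold h : set 'rV[R]_n := [set x | h x = 0].

Definition tangent_space h x : set 'rV[R]_n := [set xi | 'd h x xi = 0].

(* The row space of [kermx ('J h x)] is [tangent_space h x]. *)
Definition tangent_proj h x xi : 'rV[R]_n :=
  xi *m orth_proj (kermx ('J h x)).

Definition rgrad h f x : 'rV[R]_n :=
  tangent_proj h x (euclidean_gradient f x).

(* [rgrad h f] is given by the same formula off the manifold, so it is its own
   extension to the ambient space and can be differentiated there. *)
Definition rhess h f x xi : 'rV[R]_n :=
  tangent_proj h x ('D_xi (rgrad h f) x).

Definition opnorm (T : set 'rV[R]_n) (E : 'rV[R]_n -> 'rV[R]_n) : R :=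
  sup [set norm2 (E xi) | xi in [set xi | T xi /\ norm2 xi <= 1]].

(* (hess f(x) + E) xi = - grad f(x) for some linear operator E on the tangent
   space at x with ||E||_2 <= gamma ||grad f(x)||_2. *)
Definition approximate_newton_direction h f (gamma : R) x xi :=
  exists E : {linear 'rV[R]_n -> 'rV[R]_n},
    [/\ forall z, tangent_space h x z -> tangent_space h x (E z),
        rhess h f x xi + E xi = - rgrad h f x &
        opnorm (tangent_space h x) E <= gamma * norm2 (rgrad h f x)].

Definition approximate_newton h f (gamma : R) (N : nat)
    (x_ xi_ : nat -> 'rV[R]_n) :=
  forall k, (k < N)%N -> approximate_newton_direction h f gamma (x_ k) (xi_ k).

Definition superlinear_convergence (x_ : nat -> 'rV[R]_n) (xs : 'rV[R]_n) :=
  x_ @ \oo --> xs /\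
  ((exists k, x_ k = xs) \/
   (fun k => norm2 (x_ k.+1 - xs) / norm2 (x_ k - xs)) @ \oo --> (0 : R)).

End Riemannian.

(* Nodes are [option 'I_J]: [None] is the slack node 0 and [Some j] a node of
   {1, ..., J}; line j goes from [parent j] to [Some j]. Such a graph is a tree
   rooted at the slack node iff following parents always leads to the slack. *)
Record network (R : realType) (J : nat) := Network {
  parent : 'I_J -> option 'I_J;
  resistance : 'I_J -> R;
  reactance : 'I_J -> R;
  tap : 'I_J -> R;
  shuntG : 'I_J -> R;
  shuntB : 'I_J -> R;
  slack_v : R;
  pbar : 'rV[R]_J;
  qbar : 'rV[R]_J;
  parent_rooted : forall j, exists n, iter n (obind parent) (Some j) = None;
  tap_neq0 : forall j, tap j != 0;
  slack_v_gt0 : 0 < slack_v }.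

(* x = (u, w), u = ((P, Q), (l, v)), w = (p, q) *)
Notation flows R J := 'rV[R]_((J + J) + (J + J)).
Notation injections R J := 'rV[R]_(J + J).
Notation state R J := 'rV[R]_(((J + J) + (J + J)) + (J + J)).

Section BranchFlow.
Variables (R : realType) (J : nat) (N : network R J).
Implicit Types (x xi : state R J) (u : flows R J) (v : 'rV[R]_J) (j : 'I_J).

Local Notation i_ := (parent N).
Local Notation r_ := (resistance N).
Local Notation x_ := (reactance N).
Local Notation a_ := (tap N).

Definition u_part x : flows R J := lsubmx x.
Definition w_part x : injections R J := rsubmx x.
Definition flowP u : 'rV[R]_J := lsubmx (lsubmx u).
Definition flowQ u : 'rV[R]_J := rsubmx (lsubmx u).
Definition currents u : 'rV[R]_J := lsubmx (rsubmx u).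
Definition voltages u : 'rV[R]_J := rsubmx (rsubmx u).

Definition wbar : injections R J := row_mx (pbar N) (qbar N).

Definition node_v v (i : option 'I_J) : R :=
  if i is Some k then v 0 k else slack_v N.

Definition balanceR u j : R :=
  \sum_(k < J | i_ k == Some j) flowP u 0 k - flowP u 0 j
  + a_ j ^+ 2 * r_ j * currents u 0 j + shuntG N j * voltages u 0 j.

Definition balanceI u j : R :=
  \sum_(k < J | i_ k == Some j) flowQ u 0 k - flowQ u 0 j
  + a_ j ^+ 2 * x_ j * currents u 0 j - shuntB N j * voltages u 0 j.

(* Right-hand side of the voltage equation of line j, from the squared
   voltage vi of its parent, the flows P, Q and the squared current l. *)
Definition voltage_drop (vi P Q l : R) j : R :=
  vi / a_ j ^+ 2 - 2 * (r_ j * P + x_ j * Q)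
  + a_ j ^+ 2 * (r_ j ^+ 2 + x_ j ^+ 2) * l.

(* The residuals of (R), (I), (V), (C). *)
Definition F_bfm x : flows R J :=
  let u := u_part x in
  let P := flowP u in let Q := flowQ u in
  let l := currents u in let v := voltages u in
  let w := w_part x in
  row_mx
    (row_mx (\row_j (balanceR u j - lsubmx w 0 j))
            (\row_j (balanceI u j - rsubmx w 0 j)))
    (row_mx
      (\row_j (v 0 j -
               voltage_drop (node_v v (i_ j)) (P 0 j) (Q 0 j) (l 0 j) j))
      (\row_j (node_v v (i_ j) * l 0 j - (P 0 j ^+ 2 + Q 0 j ^+ 2)))).

Definition M_bfm : set (state R J) := level_manifold F_bfm.
Definition tangent_bfm x : set (state R J) := tangent_space F_bfm x.

Definition f_bfm x : R := norm2 (w_part x - wbar) ^+ 2.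
Definition grad_bfm x : state R J := rgrad F_bfm f_bfm x.

Definition load_flow x := M_bfm x /\ w_part x = wbar.

(* The retraction divides by the squared voltages of the parent nodes. *)
Definition parent_voltages_neq0 v := forall j, node_v v (i_ j) != 0.

Definition retr_l (P Q v : 'rV[R]_J) j : R :=
  (P 0 j ^+ 2 + Q 0 j ^+ 2) / node_v v (i_ j).

(* One root-to-leaves pass: after k passes the nodes at depth <= k have their
   final value, whatever the initial one. All depths are at most J. *)
Definition retr_sweep (P Q v : 'rV[R]_J) : 'rV[R]_J :=
  \row_j voltage_drop (node_v v (i_ j)) (P 0 j) (Q 0 j) (retr_l P Q v j) j.

Definition retr_v (P Q : 'rV[R]_J) : 'rV[R]_J := iter J (retr_sweep P Q) 0.

Lemma depth_le (j : 'I_J) : iter J (obind i_) (Some j) = None.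
Proof.
set g := obind i_; have iterN n : iter n g None = None.
  by elim: n => //= n ->.
case E : (iter J g (Some j)) => [k0|//]; exfalso.
have someP k : (k <= J)%N -> iter k g (Some j) <> None.
  move=> kJ e; have : iter (J - k + k) g (Some j) = None by rewrite iterD e iterN.
  by rewrite subnK // E.
pose h (k : 'I_J.+1) := odflt j (iter k g (Some j)).
suff /leq_card : injective h by rewrite !card_ord ltnn.
have cyc a b : (a < b)%N -> (b <= J)%N ->
    iter a g (Some j) <> iter b g (Some j).
  move=> ab bJ e; have [n nN] := parent_rooted N j.
  have per m : iter (m * (b - a) + a) g (Some j) = iter a g (Some j).
    elim: m => [|m IH] //.
    by rewrite mulSn -addnA iterD IH -iterD subnK ?e // ltnW.
  apply: (@someP a); first by rewrite (leq_trans (ltnW ab)).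
  have le : (n <= n * (b - a) + a)%N.
    by rewrite (leq_trans _ (leq_addr _ _)) // leq_pmulr // subn_gt0.
  by rewrite -(per n) -[X in iter X](subnK le) iterD nN iterN.
have heq (a b : 'I_J.+1) : h a = h b -> iter a g (Some j) = iter b g (Some j).
  have := @someP a (ltn_ord a); have := @someP b (ltn_ord b); rewrite /h.
  by case: (iter a g _) => // x; case: (iter b g _) => //= y _ _ ->.
move=> a b /heq e; apply/val_inj/eqP; case: ltngtP => //= ab.
- by case: (cyc _ _ ab (ltn_ord b)).
- by case: (cyc _ _ ab (ltn_ord a)).
Qed.

Lemma retr_vP (P Q : 'rV[R]_J) : retr_v P Q = retr_sweep P Q (retr_v P Q).
Proof.
rewrite /retr_v -iterS; set s := retr_sweep P Q.
have fixed k i : iter k (obind i_) i = None ->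
    node_v (iter k s 0) i = node_v (iter k.+1 s 0) i.
  elim: k i => [|k IH] [j|] //; rewrite iterSr /= => /IH eqv.
  by rewrite !mxE /retr_l eqv.
by apply/rowP => j; exact: (fixed J (Some j) (depth_le j)).
Qed.

Definition retraction x xi : state R J :=
  let u := u_part (x + xi) in
  let P := flowP u in let Q := flowQ u in
  let v := retr_v P Q in
  let u' := row_mx (row_mx P Q) (row_mx (\row_j retr_l P Q v j) v) in
  row_mx u' (row_mx (\row_j balanceR u' j) (\row_j balanceI u' j)).

(* No division by zero occurs in [retraction x xi]. *)
Definition retraction_defined x xi :=
  parent_voltages_neq0 (voltages (u_part (retraction x xi))).

(* The linear system for xi = (zeta, eta): tangency and w + eta = wbar. *)
Definition newton_system x xi :=
  tangent_bfm x xi /\ w_part x + w_part xi = wbar.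

(* Its coefficient matrix, one row per scalar equation. *)
Definition newton_system_mx x :
    'M[R]_(((J + J) + (J + J)) + (J + J), ((J + J) + (J + J)) + (J + J)) :=
  col_mx ('J F_bfm x)^T (row_mx 0 1%:M).

Definition regular_point : set (state R J) :=
  [set x | [/\ M_bfm x, parent_voltages_neq0 (voltages (u_part x)) &
               row_free (newton_system_mx x)]].

Definition armijo (sigma : R) x xi (t : R) :=
  retraction_defined x (t *: xi) /\
  f_bfm x - f_bfm (retraction x (t *: xi)) >=
    - sigma * dot (grad_bfm x) (t *: xi).

Definition bfm_step (alpha beta sigma : R) x xi x' :=
  newton_system x xi /\
  exists m : nat,
    [/\ armijo sigma x xi (beta ^+ m * alpha),
        forall k, (k < m)%N -> ~ armijo sigma x xi (beta ^+ k * alpha) &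
        x' = retraction x ((beta ^+ m * alpha) *: xi)].

(* [Some eps] is the tolerance of the stopping test; [None] omits the test. *)
Definition loop_test (eps : option R) x :=
  if eps is Some e then e < norm2 (grad_bfm x) else true.

(* The first n iterations of the algorithm, from x_0 to x_n. *)
Definition bfm_run (alpha beta sigma : R) (eps : option R) (n : nat)
    (xs xis : nat -> state R J) :=
  [/\ M_bfm (xs 0%N), parent_voltages_neq0 (voltages (u_part (xs 0%N))) &
      forall k, (k < n)%N ->
        loop_test eps (xs k) /\
        bfm_step alpha beta sigma (xs k) (xis k) (xs k.+1)].

End BranchFlow.

(* To first order f(R_x(t xi)) = (1 - t)^2 f(x) along a Newton direction, and
   the Armijo rule accepts (1 - t)^2 f(x) iff t <= 2 (1 - sigma). This says
   that the first accepted stepsize of the sequence beta^m alpha is then 1;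
   it holds for instance when alpha = 1 and sigma < 1/2. *)
Definition armijo_selects_unit_step (R : realType) (alpha beta sigma : R) :=
  sigma < 2^-1 /\
  exists m : nat, beta ^+ m * alpha = 1 /\
    forall k, (k < m)%N -> 2 * (1 - sigma) < beta ^+ k * alpha.

(* Main.v *)
Require Import Defs.
From HB Require Import structures.
From mathcomp Require Import all_boot all_order all_algebra.
From mathcomp Require Import all_classical all_reals all_analysis.
From mathcomp Require Import ring lra.
Import Order.TTheory GRing.Theory Num.Theory.
Import numFieldNormedType.Exports.
Set Implicit Arguments.
Unset Strict Implicit.
Unset Printing Implicit Defensive.
Local Open Scope classical_set_scope.
Local Open Scope ring_scope.

(* Let W = w - wbar, let A be the Jacobian of F_bfm and Pi the orthogonal
   projection onto ker A. Along a Newton direction xi one has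
   W(x + t xi) = (1 - t) W(x), so the Euclidean gradient g = (0, 2 W) scales in
   the same way and <grad f, xi> = -2 f. Hence hess f xi + grad f is the
   curvature term Pi D_xi Pi g. Wherever the bordered matrix of the linear
   system is invertible, the norm nu of its inverse bounds a left inverse of A,
   |xi| <= nu |W| and 2 |W| <= nu |grad f|, so this term is at most
   c nu^2 |grad f| |xi| and is cancelled by a rank one operator E.
   The retraction differs from x + xi by O(|xi|^2), by induction on the depth
   of the nodes; thus |W| becomes |1 - t| |W| + O(t^2 |xi|^2) after a step t.
   This gives the termination of the line search, a lower bound on the accepted
   stepsizes and, for unit steps, quadratic convergence, since |x - x*| and
   |W(x)| are comparable for x on the manifold near a regular solution x*. *)

(** The equations are polynomials of degree two, so their second-order Taylor expansion is exact,
    the Jacobian is affine and the second derivative [H] is constant. The Hessian estimates are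
    therefore made for an abstract quadratic constraint; the network enters through its bilinear
    part and its retraction. The obstacle is that [rhess] differentiates an orthogonal projection,
    whose regularity relies on a Jacobian of full rank; under that condition an exact formula for
    the difference of two projections replaces a smoothness argument. At other points nothing is
    known of the derivative, but off the solutions both gradient and direction are nonzero, so each
    direction, hence each finite run, has some constant [gamma]; uniform constants need the inverse.
    Near a solution the line search controls the residual, not the distance to [xstar]: the residual
    is the invariant, and the distance is recovered from it. A stepsize t shrinks the residual by
    about |1 - t|, so a superlinear rate asks for stepsizes that are eventually 1. *)

Section Norms.
Context {R : realType}.

Lemma dotE n (u v : 'rV[R]_n) : dot u v = (u *m v^T) 0 0.
Proof. by rewrite mxE; apply: eq_bigr => i _; rewrite mxE. Qed.

Lemma dotC n (u v : 'rV[R]_n) : dot u v = dot v u.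
Proof. by apply: eq_bigr => i _; rewrite mulrC. Qed.

Lemma dotDl n (u v w : 'rV[R]_n) : dot (u + v) w = dot u w + dot v w.
Proof. by rewrite !dotE mulmxDl mxE. Qed.

Lemma dotZl n a (u v : 'rV[R]_n) : dot (a *: u) v = a * dot u v.
Proof. by rewrite !dotE -scalemxAl mxE. Qed.

Lemma dotNl n (u v : 'rV[R]_n) : dot (- u) v = - dot u v.
Proof. by rewrite -scaleN1r dotZl mulN1r. Qed.

Lemma dotBl n (u v w : 'rV[R]_n) : dot (u - v) w = dot u w - dot v w.
Proof. by rewrite dotDl dotNl. Qed.

Lemma dotDr n (u v w : 'rV[R]_n) : dot u (v + w) = dot u v + dot u w.
Proof. by rewrite dotC dotDl !(dotC u). Qed.

Lemma dotZr n a (u v : 'rV[R]_n) : dot u (a *: v) = a * dot u v.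
Proof. by rewrite dotC dotZl (dotC u). Qed.

Lemma dotBr n (u v w : 'rV[R]_n) : dot u (v - w) = dot u v - dot u w.
Proof. by rewrite dotC dotBl !(dotC u). Qed.

Lemma dot0l n (u : 'rV[R]_n) : dot 0 u = 0.
Proof. by rewrite -(scale0r u) dotZl mul0r. Qed.

Lemma dot_row_mx n p (u u' : 'rV[R]_n) (v v' : 'rV[R]_p) :
  dot (row_mx u v) (row_mx u' v') = dot u u' + dot v v'.
Proof.
rewrite /dot big_split_ord /=.
by congr (_ + _); apply: eq_bigr => i _; rewrite ?row_mxEl ?row_mxEr.
Qed.

Lemma dot_ge0 n (u : 'rV[R]_n) : 0 <= dot u u.
Proof. by apply: sumr_ge0 => i _; rewrite -expr2 sqr_ge0. Qed.

Lemma dot_eq0 n (u : 'rV[R]_n) : (dot u u == 0) = (u == 0).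
Proof.
apply/eqP/eqP => [u0|->]; last exact: dot0l.
apply/rowP => i; rewrite mxE; apply/eqP; rewrite -sqrf_eq0 expr2.
by move/psumr_eq0P: u0 => -> // j _; rewrite -expr2 sqr_ge0.
Qed.

Lemma norm2_ge0 n (u : 'rV[R]_n) : 0 <= norm2 u.
Proof. exact: sqrtr_ge0. Qed.

Lemma sqr_norm2 n (u : 'rV[R]_n) : norm2 u ^+ 2 = dot u u.
Proof. by rewrite sqr_sqrtr ?dot_ge0. Qed.

Lemma norm2_eq0 n (u : 'rV[R]_n) : (norm2 u == 0) = (u == 0).
Proof. by rewrite -dot_eq0 -sqr_norm2 sqrf_eq0. Qed.

Lemma norm20 n : norm2 (0 : 'rV[R]_n) = 0.
Proof. by apply/eqP; rewrite norm2_eq0. Qed.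

Lemma norm2_gt0 n (u : 'rV[R]_n) : (0 < norm2 u) = (u != 0).
Proof. by rewrite lt_neqAle norm2_ge0 andbT eq_sym norm2_eq0. Qed.

Lemma norm2Z n a (u : 'rV[R]_n) : norm2 (a *: u) = `|a| * norm2 u.
Proof.
by rewrite /norm2 dotZl dotZr mulrA -expr2 sqrtrM ?sqr_ge0// sqrtr_sqr.
Qed.

Lemma norm2N n (u : 'rV[R]_n) : norm2 (- u) = norm2 u.
Proof. by rewrite -scaleN1r norm2Z normrN1 mul1r. Qed.

Lemma cauchy_schwarz n (u v : 'rV[R]_n) : dot u v <= norm2 u * norm2 v.
Proof.
have [->|u0] := eqVneq u 0; first by rewrite dot0l mulr_ge0 ?norm2_ge0.
have [->|v0] := eqVneq v 0; first by rewrite dotC dot0l mulr_ge0 ?norm2_ge0.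
have := dot_ge0 (norm2 v *: u - norm2 u *: v).
rewrite dotBl !dotBr !dotZl !dotZr -!sqr_norm2 (dotC v u).
move: (norm2 u) (norm2 v) (norm2_gt0 u) (norm2_gt0 v) (dot u v).
rewrite u0 v0 => a b a0 b0 c h.
have ab : 0 < a * b by exact: mulr_gt0.
by rewrite -subr_ge0 -(pmulr_rge0 _ ab); nra.
Qed.

Lemma ler_norm2D n (u v : 'rV[R]_n) : norm2 (u + v) <= norm2 u + norm2 v.
Proof.
rewrite -(@ler_pXn2r _ 2) ?nnegrE ?addr_ge0 ?norm2_ge0//.
rewrite sqrrD !sqr_norm2 dotDl !dotDr (dotC v u).
by have := cauchy_schwarz u v; lra.
Qed.

Lemma ler_norm2B n (u v : 'rV[R]_n) : norm2 (u - v) <= norm2 u + norm2 v.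
Proof. by rewrite -(norm2N v) ler_norm2D. Qed.

Lemma coord_le_norm2 n (u : 'rV[R]_n) i : `|u 0 i| <= norm2 u.
Proof.
rewrite -sqrtr_sqr ler_sqrt ?dot_ge0// /dot (bigD1 i)//= -expr2 lerDl.
by apply: sumr_ge0 => j _; rewrite -expr2 sqr_ge0.
Qed.

Lemma norm2_row_mx n p (u : 'rV[R]_n) (v : 'rV[R]_p) :
  norm2 (row_mx u v) <= norm2 u + norm2 v.
Proof.
rewrite -(@ler_pXn2r _ 2) ?nnegrE ?addr_ge0 ?norm2_ge0//.
rewrite sqrrD !sqr_norm2 dot_row_mx.
by have := mulr_ge0 (norm2_ge0 u) (norm2_ge0 v); lra.
Qed.

Lemma norm2_rsubmx n p (u : 'rV[R]_(n + p)) : norm2 (rsubmx u) <= norm2 u.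
Proof.
rewrite ler_sqrt ?dot_ge0// -{3 4}[u]hsubmxK dot_row_mx lerDr.
exact: dot_ge0.
Qed.

Lemma norm2_row0l n p (v : 'rV[R]_p) :
  norm2 (row_mx (0 : 'rV[R]_n) v) = norm2 v.
Proof. by rewrite /norm2 dot_row_mx dot0l add0r. Qed.

(** Preferred to an operator norm: it is submultiplicative, invariant under transposition, monotone
    on blocks, and dominates the action on [norm2] ([norm2M]), at the price of dimension-dependent
    constants. *)
Definition norm1 m n (A : 'M[R]_(m, n)) : R := \sum_i \sum_j `|A i j|.

Lemma norm1_ge0 m n (A : 'M[R]_(m, n)) : 0 <= norm1 A.
Proof. by apply: sumr_ge0 => i _; apply: sumr_ge0. Qed.

Lemma ler_norm1D m n (A B : 'M[R]_(m, n)) : norm1 (A + B) <= norm1 A + norm1 B.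
Proof.
rewrite -big_split; apply: ler_sum => i _; rewrite -big_split.
by apply: ler_sum => j _; rewrite mxE ler_normD.
Qed.

Lemma norm1Z m n a (A : 'M[R]_(m, n)) : norm1 (a *: A) = `|a| * norm1 A.
Proof.
rewrite mulr_sumr; apply: eq_bigr => i _; rewrite mulr_sumr.
by apply: eq_bigr => j _; rewrite mxE normrM.
Qed.

Lemma norm1N m n (A : 'M[R]_(m, n)) : norm1 (- A) = norm1 A.
Proof. by rewrite -scaleN1r norm1Z normrN1 mul1r. Qed.

Lemma norm1T m n (A : 'M[R]_(m, n)) : norm1 A^T = norm1 A.
Proof.
rewrite /norm1 exchange_big; apply: eq_bigr => i _.
by apply: eq_bigr => j _; rewrite mxE.
Qed.

Lemma norm1_sum I (r : seq I) m n (A : I -> 'M[R]_(m, n)) :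
  norm1 (\sum_(i <- r) A i) <= \sum_(i <- r) norm1 (A i).
Proof.
elim: r => [|i r IH]; last first.
  by rewrite !big_cons (le_trans (ler_norm1D _ _))// lerD2l.
rewrite !big_nil /norm1 big1// => i _; rewrite big1// => j _.
by rewrite mxE normr0.
Qed.

Lemma ler_coord_norm1 m n (A : 'M[R]_(m, n)) i j : `|A i j| <= norm1 A.
Proof.
rewrite /norm1 (bigD1 i)//= (bigD1 j)//= -addrA lerDl addr_ge0 //.
  exact: sumr_ge0.
by apply: sumr_ge0 => k _; apply: sumr_ge0.
Qed.

Lemma norm1M m n p (A : 'M[R]_(m, n)) (B : 'M[R]_(n, p)) :
  norm1 (A *m B) <= norm1 A * norm1 B.
Proof.
rewrite mulr_suml; apply: ler_sum => i _.
rewrite (@le_trans _ _ (\sum_j \sum_k `|A i k| * `|B k j|))//.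
  apply: ler_sum => j _; rewrite mxE (le_trans (ler_norm_sum _ _ _))//.
  by apply: ler_sum => k _; rewrite normrM.
rewrite exchange_big mulr_suml; apply: ler_sum => k _; rewrite -mulr_sumr.
rewrite ler_wpM2l// /norm1 (bigD1 k)//= lerDl.
by apply: sumr_ge0 => l _; apply: sumr_ge0.
Qed.

Lemma norm2_le_norm1 n (u : 'rV[R]_n) : norm2 u <= norm1 u.
Proof.
rewrite -(@ler_pXn2r _ 2) ?nnegrE ?norm1_ge0 ?norm2_ge0// sqr_norm2.
rewrite expr2 {1}/norm1 big_ord1 mulr_suml; apply: ler_sum => i _.
rewrite (le_trans (ler_norm _))// normrM ler_wpM2l//.
exact: ler_coord_norm1.
Qed.

Lemma norm2M n p (u : 'rV[R]_n) (A : 'M[R]_(n, p)) :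
  norm2 (u *m A) <= norm2 u * norm1 A.
Proof.
apply: (le_trans (norm2_le_norm1 _)); rewrite mulr_sumr.
rewrite {1}/norm1 big_ord1.
rewrite (@le_trans _ _ (\sum_j \sum_k `|u 0 k| * `|A k j|))//.
  apply: ler_sum => j _; rewrite mxE (le_trans (ler_norm_sum _ _ _))//.
  by apply: ler_sum => k _; rewrite normrM.
rewrite exchange_big; apply: ler_sum => k _; rewrite mulr_sumr.
by apply: ler_sum => j _; rewrite ler_wpM2r// coord_le_norm2.
Qed.

Lemma norm1_linear_bound n m p (L : {linear 'rV[R]_n -> 'M[R]_(m, p)}) :
  exists2 C, 0 <= C & forall u, norm1 (L u) <= C * norm2 u.
Proof.
exists (\sum_i norm1 (L (delta_mx 0 i))).
  by apply: sumr_ge0 => i _; apply: norm1_ge0.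
move=> u; rewrite {1}[u]row_sum_delta raddf_sum mulr_suml.
apply: (le_trans (norm1_sum _ _)); apply: ler_sum => i _ /=.
rewrite linearZ norm1Z mulrC ler_wpM2l ?norm1_ge0//.
exact: coord_le_norm2.
Qed.

Lemma norm_le_norm2 n (u : 'rV[R]_n) : `|u| <= norm2 u.
Proof.
rewrite [`|u|]mx_normrE; apply/bigmax_leP; split=> [|[i j] _ /=].
  exact: norm2_ge0.
by rewrite ord1 coord_le_norm2.
Qed.

Lemma norm2_le_norm n (u : 'rV[R]_n) : norm2 u <= n%:R * `|u|.
Proof.
apply: (le_trans (norm2_le_norm1 _)); rewrite /norm1 big_ord1.
rewrite mulr_natl -[n in _ *+ n]card_ord -sumr_const; apply: ler_sum => i _.
by rewrite [`|u|]mx_normrE;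
  apply: (le_bigmax _ (fun ij => `|u ij.1 ij.2|) (0, i)).
Qed.

Lemma near_norm2P n (x : 'rV[R]_n) (P : set 'rV[R]_n) :
  (exists2 e, 0 < e & forall y, norm2 (y - x) < e -> P y) ->
  \forall y \near x, P y.
Proof.
move=> [e e0 H]; apply/nbhs_ballP; exists (e / (n.+1)%:R) => /=.
  by rewrite divr_gt0.
move=> y; rewrite -ball_normE /= => xy; apply: H.
rewrite (le_lt_trans (norm2_le_norm _))// distrC.
apply: (@le_lt_trans _ _ (n.+1%:R * `|x - y|));
  last by rewrite mulrC -ltr_pdivlMr.
by rewrite ler_wpM2r// ler_nat.
Qed.

Lemma cvg_norm2P n (u : nat -> 'rV[R]_n) x :
  (fun k => norm2 (u k - x)) @ \oo --> (0 : R) -> u @ \oo --> x.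
Proof.
move=> u0; apply/cvgrPdist_lt => e e0; move/cvgrPdist_lt : u0 => /(_ e e0).
apply: filterS => k; rewrite sub0r normrN ger0_norm ?norm2_ge0//.
by apply: le_lt_trans; rewrite distrC norm_le_norm2.
Qed.
End Norms.

(** * Orthogonal projections onto row spaces and kernels *)

Section OrthogonalProjection.
Context {R : realType}.

(** The diagonal of [A *m A^T] holds the squared row norms. This positivity makes a row space meet
    its orthogonal complement trivially. *)
Lemma mul_mx_tr_eq0 m n (A : 'M[R]_(m, n)) : (A *m A^T == 0) = (A == 0).
Proof.
apply/eqP/eqP => [AA0|->]; last by rewrite mul0mx.
apply/row_matrixP => i; rewrite row0; apply/eqP; rewrite -dot_eq0 dotE.
apply/eqP; transitivity ((A *m A^T) i i); last by rewrite AA0 mxE.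
by rewrite !mxE; apply: eq_bigr => k _; rewrite !mxE.
Qed.

Section Proj.
Variables (p n : nat) (U : 'M[R]_(p, n)).
Let V := kermx U^T.
Local Notation P := (orth_proj U).

Lemma capmx_orth : (<<U>> :&: V = 0)%MS.
Proof.
apply/eqP; rewrite -submx0; set W := (_ :&: _)%MS.
have /submxP[D WE] : (W <= U)%MS by rewrite (submx_trans (capmxSl _ _))//
  genmxE.
have /sub_kermxP W0 : (W <= V)%MS by exact: capmxSr.
by rewrite submx0 -mul_mx_tr_eq0 {2}WE trmx_mul mulmxA W0 mul0mx.
Qed.

Lemma addsmx_orth m (W : 'M[R]_(m, n)) : (W <= <<U>> + V)%MS.
Proof.
apply: submx_full; rewrite /row_full mxrank_disjoint_sum ?capmx_orth//.
by rewrite genmxE mxrank_ker mxrank_tr subnKC// rank_leq_col.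
Qed.

Lemma orth_proj_sub : (orth_proj U <= U)%MS.
Proof. by rewrite -[X in (X <= _)%MS]mul1mx (submx_trans (proj_mx_sub _ _ _))
  ?genmxE. Qed.

Lemma orth_proj_id m (W : 'M[R]_(m, n)) : (W <= U)%MS -> W *m orth_proj U = W.
Proof. by move=> WU; rewrite proj_mx_id ?capmx_orth ?genmxE. Qed.

Lemma orth_proj_compl : (1%:M - orth_proj U) *m U^T = 0.
Proof.
rewrite -[X in _ - X]mul1mx; apply/sub_kermxP.
exact: proj_mx_compl_sub (addsmx_orth _).
Qed.
End Proj.

End OrthogonalProjection.

(* Locked, because [proj_mx] unfolds to a matrix product, on which [mulmxA]
   would otherwise rewrite. *)
HB.lock Definition ker_proj (R : realType) n m (A : 'M[R]_(n, m)) : 'M[R]_n :=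
  orth_proj (kermx A).

Section KernelProjection.
Context {R : realType}.

Section Proj.
Variables (n m : nat) (A : 'M[R]_(n, m)).
Local Notation P := (ker_proj A).

Lemma mul_ker_proj : P *m A = 0.
Proof. by apply/sub_kermxP; rewrite ker_proj.unlock orth_proj_sub. Qed.

Lemma ker_proj_id p (W : 'M[R]_(p, n)) : W *m A = 0 -> W *m P = W.
Proof. by move=> /sub_kermxP WA; rewrite ker_proj.unlock orth_proj_id. Qed.

Lemma ker_projK : P *m P = P.
Proof. by rewrite ker_proj_id ?mul_ker_proj. Qed.

(** The rows of [P] lie in the kernel and those of [1 - P] are orthogonal to it, so
    [(1 - P) *m P^T = 0]; thus [P^T = P *m P^T], which is symmetric. *)
Lemma ker_proj_tr : P^T = P.
Proof.
have PP : P^T = P *m P^T.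
  have /sub_kermxP/submxP[D PE] := mul_ker_proj.
  apply/eqP; rewrite -subr_eq0 -{1}[P^T]mul1mx -mulmxBl {2}PE trmx_mul mulmxA.
  by rewrite ker_proj.unlock orth_proj_compl mul0mx.
by have := congr1 trmx PP; rewrite trmx_mul trmxK -PP.
Qed.

Lemma dot_ker_proj (u v : 'rV[R]_n) : dot (u *m P) v = dot u (v *m P).
Proof. by rewrite !dotE trmx_mul ker_proj_tr mulmxA. Qed.

Lemma norm2_ker_proj (u : 'rV[R]_n) : norm2 (u *m P) <= norm2 u.
Proof.
rewrite -(@ler_pXn2r _ 2) ?nnegrE ?norm2_ge0// !sqr_norm2.
have := dot_ge0 (u - u *m P); rewrite dotBl !dotBr !dot_ker_proj.
by rewrite -!mulmxA !ker_projK; lra.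
Qed.

(** A contraction has entries of size at most 1. The bound is independent of [A], so it serves along
    a line before any continuity of the projection is known. *)
Lemma norm1_ker_proj : norm1 P <= n%:R ^+ 2.
Proof.
apply: (@le_trans _ _ (\sum_(i < n) \sum_(j < n) 1)); last first.
  by rewrite !sumr_const card_ord -mulrnA natrM expr2.
apply: ler_sum => i _; apply: ler_sum => j _.
have -> : P i j = ((delta_mx 0 i : 'rV_n) *m P) 0 j by rewrite -rowE mxE.
rewrite (le_trans (coord_le_norm2 _ _))// (le_trans (norm2_ker_proj _))//.
rewrite /norm2 /dot (bigD1 i)//= big1 ?addr0 ?mxE ?eqxx/= ?mulr1 ?sqrtr1//.
by move=> k ki; rewrite mxE (negPf ki) andbF mul0r.
Qed.
End Proj.

(** * Variation of the kernel projection with the matrix *)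

Section Perturbation.
Variables n m : nat.
Implicit Types (A : 'M[R]_(n, m)) (X : 'M[R]_(m, n)).
Local Notation Pi A := (ker_proj A).

(** The rows of [1 - A *m X] lie in the kernel of [A], hence are annihilated by [1 - Pi A]. *)
Lemma ker_proj_compl A X : X *m A = 1%:M ->
  1%:M - Pi A = A *m X *m (1%:M - Pi A).
Proof.
move=> XA; apply/eqP; rewrite -subr_eq0 -{1}[1%:M - _]mul1mx -mulmxBl mulmxBr
  mulmx1.
by rewrite ker_proj_id ?subrr// mulmxBl -mulmxA XA mulmx1 mul1mx subrr.
Qed.

(** Write [Pi A' - Pi A = Pi A' *m (1 - Pi A) - (1 - Pi A') *m Pi A], insert [ker_proj_compl] in
    each product and use [Pi A' *m A' = 0]. The identity is exact and contains the factor [A' - A],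
    so no limit is taken. *)
Lemma ker_projB A A' X X' : X *m A = 1%:M -> X' *m A' = 1%:M ->
  Pi A' - Pi A = - (Pi A' *m (A' - A) *m X *m (1%:M - Pi A)
                  + (Pi A *m (A' - A) *m X' *m (1%:M - Pi A'))^T).
Proof.
move=> XA XA'.
have compl (B B' : 'M[R]_(n, m)) (Y : 'M[R]_(m, n)) : Y *m B = 1%:M ->
    Pi B' *m (B' - B) *m Y *m (1%:M - Pi B) = - (Pi B' *m (1%:M - Pi B)).
  move=> YB; rewrite (mulmxBr (Pi B')) mul_ker_proj sub0r !mulNmx.
  by rewrite [in RHS](ker_proj_compl YB) !mulmxA.
rewrite compl// -[A' - A]opprB mulmxN !mulNmx compl// opprK.
have -> : (Pi A *m (1%:M - Pi A'))^T = (1%:M - Pi A') *m Pi A.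
  by rewrite trmx_mul linearB/= trmx1 !ker_proj_tr.
by rewrite mulmxBr mulmx1 mulmxBl mul1mx opprD opprK opprB addrA subrK.
Qed.
End Perturbation.
End KernelProjection.

(** * Derivatives from quadratic error bounds, and exactly quadratic maps *)

Section Derivatives.
Context {R : realType}.

(** Only the restriction to a line is examined, so the Riemannian gradient need not be shown
    differentiable as a map. *)
Lemma derive_quadratic_error (V W : normedModType R) (f : V -> W) x v df C e :
  0 < e ->
  (forall t, `|t| < e -> `|f (x + t *: v) - f x - t *: df| <= C * t ^+ 2) ->
  'D_v f x = df.
Proof.
move=> e0 fC; apply/cvg_lim => //=; apply/cvgrPdist_lt => d d0.
have C0 : 0 < `|C| + 1 by rewrite ltr_wpDl.
exists (Num.min e (d / (`|C| + 1))) => /=; first by rewrite lt_min e0 divr_gt0.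
move=> t /=; rewrite sub0r normrN lt_min => /andP[te td] t0.
rewrite -[df](scalerK t0) -scalerBr normrZ normfV ltr_pdivrMl ?normr_gt0//.
rewrite -normrN opprB [t *: v + x]addrC.
rewrite (le_lt_trans (fC t te))// -[t ^+ 2]real_normK ?num_real// expr2.
rewrite mulrCA; have t0' : 0 < `|t| by rewrite normr_gt0.
rewrite ltr_pM2l//; move: td; rewrite ltr_pdivlMr// => td.
by have := ler_norm C; nra.
Qed.

Lemma mulmxr_continuous n p (A : 'M[R]_(n, p)) :
  continuous (mulmxr A : 'rV[R]_n -> 'rV[R]_p).
Proof.
apply/linear_bounded_continuous/linear_boundedP.
exists (n%:R * norm1 A); split=> [|r /ltW Ar x /=]; first exact: num_real.
rewrite (le_trans (norm_le_norm2 _))// (le_trans (norm2M _ _))//.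
rewrite (@le_trans _ _ (n%:R * `|x| * norm1 A))//.
  by rewrite ler_wpM2r ?norm1_ge0// norm2_le_norm.
by rewrite mulrAC ler_wpM2r.
Qed.
End Derivatives.

Section QuadraticMap.
Context {R : realType}.
Variables (n m : nat) (h : 'rV[R]_n -> 'rV[R]_m) (L : 'M[R]_(n, m)).
Variable H : {linear 'rV[R]_n -> 'M[R]_(n, m)}.
Hypothesis hE : forall x xi,
  h (x + xi) = h x + xi *m (L + H x) + 2^-1 *: (xi *m H xi).

Lemma diff_quadratic x : 'd h x = mulmxr (L + H x) :> (_ -> _).
Proof.
apply: diff_unique; first exact: mulmxr_continuous.
apply/eqaddoP => e e0.
have [C C0 HC] := norm1_linear_bound H.
(* One of the two factors [norm2 y] of the remainder is converted to the max norm, which costs the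
   factor [n]. *)
apply: near_norm2P; exists (e / (C * n%:R + 1)).
  by rewrite divr_gt0// ltr_wpDl// mulr_ge0.
move=> y; rewrite subr0 => y_small.
rewrite [X in `|X|](_ : _ = 2^-1 *: (y *m H y)); last first.
  by rewrite !fctE /= [y + x]addrC hE addrAC subrr add0r.
rewrite normrZ (le_trans (ler_wpM2l _ (norm_le_norm2 _)))//.
rewrite (le_trans (ler_wpM2l _ (norm2M _ _)))//=.
rewrite ger0_norm//.
rewrite mulrC ler_pdivrMr// (le_trans (ler_wpM2l (norm2_ge0 _) (HC y)))//.
move: y_small; rewrite ltr_pdivlMr ?ltr_wpDl// ?mulr_ge0// => y_small.
have := norm2_le_norm y; have := norm2_ge0 y; have := normr_ge0 y.
move: (norm2 y) y_small => a y_small y0 a0 ay.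
have : a * C * a <= (n%:R * `|y|) * C * a by rewrite !ler_wpM2r.
have : `|y| * (n%:R * C * a) <= `|y| * e.
  by rewrite ler_wpM2l//; lra.
by have := mulr_ge0 (ltW e0) y0; lra.
Qed.

Lemma jacobian_quadratic x : 'J h x = L + H x.
Proof. by apply/row_matrixP => i; rewrite !rowE mul_rV_lin1 diff_quadratic. Qed.

Lemma tangent_quadratic x xi : tangent_space h x xi <-> xi *m 'J h x = 0.
Proof. by rewrite /tangent_space /= diff_quadratic jacobian_quadratic. Qed.

Lemma jacobian_quadraticD x y : 'J h (x + y) = 'J h x + H y.
Proof. by rewrite !jacobian_quadratic linearD addrA. Qed.

Lemma quadraticE x xi : h (x + xi) = h x + xi *m 'J h x + 2^-1 *: (xi *m H xi).
Proof. by rewrite jacobian_quadratic hE. Qed.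
End QuadraticMap.

Lemma tangent_projE (R : realType) n m (h : 'rV[R]_n -> 'rV[R]_m) x xi :
  tangent_proj h x xi = xi *m ker_proj ('J h x).
Proof. by rewrite /tangent_proj ker_proj.unlock. Qed.

(** * Matrix identities for the derivative of the projected gradient *)

Lemma mulmx4Z (R : comPzRingType) n1 n2 n3 n4 n5 t (A : 'M[R]_(n1, n2))
    (B : 'M[R]_(n2, n3)) (C : 'M[R]_(n3, n4)) (D : 'M[R]_(n4, n5)) :
  A *m (t *: B) *m C *m D = t *: (A *m B *m C *m D).
Proof. by rewrite -scalemxAr -!scalemxAl. Qed.

(** Shows that the difference quotient of the projection differs from its limit by terms containing
    [P' - P] or [X' - X], each of first order in t. *)
Lemma projection_derivativeB (R : comPzRingType) n m (P P' : 'M[R]_n)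
    (A : 'M[R]_(n, m)) (X X' : 'M[R]_(m, n)) :
  (P' *m A *m X *m (1%:M - P) + (P *m A *m X' *m (1%:M - P'))^T)
  - (P *m A *m X *m (1%:M - P) + (P *m A *m X *m (1%:M - P))^T) =
  (P' - P) *m (A *m X *m (1%:M - P)) +
  (P *m A *m ((X' - X) *m (1%:M - P') - X *m (P' - P)))^T.
Proof.
rewrite opprD addrACA; congr (_ + _); first by rewrite mulmxBl !mulmxA.
rewrite -linearB; congr (_^T).
rewrite -!(mulmxA (P *m A)) -mulmxBr; congr (_ *m _).
rewrite mulmxBl -addrA -opprD -mulmxDr; congr (_ - _ *m _).
by rewrite [RHS]addrA subrK.
Qed.

Lemma projection_remainder (R : comPzRingType) n (g : 'rV[R]_n)
    (P P' D D0 : 'M[R]_n) t : P' - P = - (t *: D) ->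
  ((1 - t) *: g) *m P' - g *m P - t *: (- (g *m D0) - g *m P) =
  t *: (g *m (t *: D - (D - D0))).
Proof.
move=> /eqP; rewrite subr_eq addrC => /eqP ->.
rewrite -!scalemxAl !mulmxBr -!scalemxAr.
move: (g *m P) (g *m D) (g *m D0) => a b c.
by apply/rowP => i; rewrite !mxE; ring.
Qed.

(** The terms [g *m P] cancel because [P] is idempotent, and [(1 - P) *m P = 0] removes half of the
    derivative of the projection. What survives is the normal part of [g] paired with the second
    fundamental form. *)
Lemma projection_defect (R : comPzRingType) n m (g : 'rV[R]_n) (P : 'M[R]_n)
    (A : 'M[R]_(n, m)) (X : 'M[R]_(m, n)) : P *m P = P -> P^T = P ->
  g *m P + (- (g *m (P *m A *m X *m (1%:M - P) +
                     (P *m A *m X *m (1%:M - P))^T)) - g *m P) *m P =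
  - (g *m (1%:M - P) *m (A *m X)^T *m P).
Proof.
move=> PP Psym; have P1 : (1%:M - P) *m P = 0 by rewrite mulmxBl PP mul1mx
  subrr.
have trE : (P *m A *m X *m (1%:M - P))^T = (1%:M - P) *m ((A *m X)^T *m P).
  by rewrite -(mulmxA P A) 2!trmx_mul Psym linearB/= trmx1 Psym.
rewrite trE mulmxBl -(mulmxA g P P) PP addrC subrK mulNmx; congr (- _).
have aP : P *m A *m X *m (1%:M - P) *m P = 0 by rewrite -mulmxA P1 mulmx0.
rewrite mulmxDr; move: aP; move: (P *m A *m X *m (1%:M - P)) => a aP.
by rewrite (mulmxDl (g *m a)) -(mulmxA g a) aP mulmx0 add0r -!mulmxA PP.
Qed.

(** * Perturbation of inverses and a calculus of orders in t *)

Section InverseMatrix.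
Context {R : realType}.

Lemma invmxB n (A B : 'M[R]_n) : A \in unitmx -> B \in unitmx ->
  invmx B - invmx A = invmx A *m (A - B) *m invmx B.
Proof.
move=> uA uB; rewrite mulmxBr mulVmx// mulmxBl mul1mx -mulmxA mulmxV//.
by rewrite mulmx1.
Qed.

(** A vector killed by [B^T] is reproduced by a map of norm at most 1/2, hence zero. The resolvent
    identity then bounds [invmx B] by half of itself plus [invmx A]. *)
Lemma invmx_perturbation n (A B : 'M[R]_n) : A \in unitmx ->
  norm1 (invmx A) * norm1 (B - A) <= 2^-1 ->
  B \in unitmx /\ norm1 (invmx B) <= 2 * norm1 (invmx A).
Proof.
move=> uA AB.
have BA : norm1 (A - B) = norm1 (B - A) by rewrite -norm1N opprB.
have uB : B \in unitmx.
  rewrite -unitmx_tr -row_free_unit; apply/inj_row_free => v vB.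
  have vE : v = v *m ((A - B)^T *m (invmx A)^T).
    rewrite -trmx_mul mulmxBr linearB/= mulVmx// trmx1 mulmxBr mulmx1.
    by rewrite trmx_mul mulmxA vB mul0mx subr0.
  apply/eqP; rewrite -norm2_eq0 eq_le norm2_ge0 andbT.
  have := norm2M v ((A - B)^T *m (invmx A)^T); rewrite -vE => v_le.
  have := norm1M (A - B)^T (invmx A)^T; rewrite !norm1T BA.
  by rewrite mulrC => c_le; have := norm2_ge0 v; nra.
split=> //; have := invmxB uA uB => /eqP; rewrite subr_eq => /eqP BE.
have : norm1 (invmx B) <= norm1 (invmx A) * norm1 (B - A) * norm1 (invmx B) +
  norm1 (invmx A).
  rewrite {1}BE (le_trans (ler_norm1D _ _))// lerD2r (le_trans (norm1M _ _))//.
  by rewrite ler_wpM2r ?norm1_ge0// (le_trans (norm1M _ _))// BA.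
by have := norm1_ge0 (invmx B); nra.
Qed.
End InverseMatrix.

Section BlockNorms.
Context {R : realType}.

Lemma norm1_col_mx m1 m2 n (A : 'M[R]_(m1, n)) (B : 'M[R]_(m2, n)) :
  norm1 (col_mx A B) = norm1 A + norm1 B.
Proof.
rewrite /norm1 big_split_ord; congr (_ + _); apply: eq_bigr => i _.
  by apply: eq_bigr => j _; rewrite col_mxEu.
by apply: eq_bigr => j _; rewrite col_mxEd.
Qed.

Lemma norm1_lsubmx m n1 n2 (A : 'M[R]_(m, n1 + n2)) :
  norm1 (lsubmx A) <= norm1 A.
Proof.
rewrite -[in leRHS](hsubmxK A) -(norm1T (row_mx _ _)) tr_row_mx norm1_col_mx.
by rewrite norm1T lerDl norm1_ge0.
Qed.

Lemma norm10 m n : norm1 (0 : 'M[R]_(m, n)) = 0.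
Proof. by rewrite -(scale0r 0) norm1Z normr0 mul0r. Qed.
End BlockNorms.

Section OrderBound.
Context {R : realType}.

(** [M t = O(t^k)] as t tends to 0, boundedness when [k = 0]. Closure under the matrix operations
    lets remainders be estimated termwise without explicit constants. *)
Definition order_bound k m n (M : R -> 'M[R]_(m, n)) :=
  exists C e, [/\ 0 <= C, 0 < e &
    forall t, `|t| < e -> norm1 (M t) <= C * `|t| ^+ k].

Lemma order_bound_cst m n (A : 'M[R]_(m, n)) : order_bound 0 (fun=> A).
Proof. by exists (norm1 A), 1; rewrite norm1_ge0; split=> // t _;
  rewrite mulr1. Qed.

Lemma order_boundM k l m n p (A : R -> 'M[R]_(m, n)) (B : R -> 'M[R]_(n, p)) :
  order_bound k A -> order_bound l B ->
  order_bound (k + l) (fun t => A t *m B t).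
Proof.
move=> [C [e [C0 e0 hA]]] [D [d [D0 d0 hB]]].
exists (C * D), (Num.min e d); rewrite mulr_ge0 ?lt_min ?e0//; split=> // t.
rewrite lt_min => /andP[/hA At /hB Bt]; rewrite (le_trans (norm1M _ _))//.
by rewrite exprD mulrACA ler_pM ?norm1_ge0.
Qed.

Lemma order_boundD k m n (A B : R -> 'M[R]_(m, n)) :
  order_bound k A -> order_bound k B -> order_bound k (fun t => A t + B t).
Proof.
move=> [C [e [C0 e0 hA]]] [D [d [D0 d0 hB]]].
exists (C + D), (Num.min e d); rewrite addr_ge0 ?lt_min ?e0//; split=> // t.
rewrite lt_min => /andP[/hA At /hB Bt]; rewrite (le_trans (ler_norm1D _ _))//.
by rewrite mulrDl lerD.
Qed.

Lemma order_boundN k m n (A : R -> 'M[R]_(m, n)) :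
  order_bound k A -> order_bound k (fun t => - A t).
Proof. by move=> [C [e [C0 e0 hA]]]; exists C, e; split=> // t; rewrite norm1N;
  exact: hA. Qed.

Lemma order_boundT k m n (A : R -> 'M[R]_(m, n)) :
  order_bound k A -> order_bound k (fun t => (A t)^T).
Proof. by move=> [C [e [C0 e0 hA]]]; exists C, e; split=> // t; rewrite norm1T;
  exact: hA. Qed.

Lemma order_bound_lsubmx k m n1 n2 (A : R -> 'M[R]_(m, n1 + n2)) :
  order_bound k A -> order_bound k (fun t => lsubmx (A t)).
Proof.
move=> [C [e [C0 e0 hA]]]; exists C, e; split=> // t te.
by rewrite (le_trans (norm1_lsubmx _))// hA.
Qed.

Lemma order_boundW k m n (A : R -> 'M[R]_(m, n)) :
  order_bound k.+1 A -> order_bound k A.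
Proof.
move=> [C [e [C0 e0 hA]]]; exists C, (Num.min e 1); split=> // [|t].
  by rewrite lt_min e0 ltr01.
rewrite lt_min => /andP[/hA At t1]; rewrite (le_trans At)// ler_wpM2l//.
by rewrite exprS ler_piMl ?exprn_ge0// ltW.
Qed.

Lemma order_boundZ k m n (A : R -> 'M[R]_(m, n)) :
  order_bound k A -> order_bound k.+1 (fun t => t *: A t).
Proof.
move=> [C [e [C0 e0 hA]]]; exists C, e; split=> // t /hA At.
by rewrite norm1Z exprS mulrCA ler_wpM2l.
Qed.

Lemma order_bound_eq k m n (A B : R -> 'M[R]_(m, n)) e : 0 < e ->
  (forall t, `|t| < e -> A t = B t) -> order_bound k A -> order_bound k B.
Proof.
move=> e0 AB [C [d [C0 d0 hA]]]; exists C, (Num.min e d).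
rewrite C0 lt_min e0; split=> // t; rewrite lt_min => /andP[te td].
by rewrite -AB// hA.
Qed.
End OrderBound.

(* Locked, to keep unification from comparing Jacobians at different points. *)
HB.lock Definition bordered_mx (R : realType) m k
    (h : 'rV[R]_(m + k) -> 'rV[R]_m) (x : 'rV[R]_(m + k)) : 'M[R]_(m + k) :=
  col_mx ('J h x)^T (row_mx 0 1%:M).

(** * Newton directions for a quadratic constraint and a residual cost *)

Section Newton.
Context {R : realType}.
Variables (m k : nat) (h : 'rV[R]_(m + k) -> 'rV[R]_m) (L : 'M[R]_(m + k, m)).
Variable H : {linear 'rV[R]_(m + k) -> 'M[R]_(m + k, m)}.
Hypothesis hE : forall x xi,
  h (x + xi) = h x + xi *m (L + H x) + 2^-1 *: (xi *m H xi).
Variable wb : 'rV[R]_k.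

Local Notation W x := (rsubmx x - wb).
Definition residual_cost (x : 'rV[R]_(m + k)) : R := norm2 (W x) ^+ 2.
Local Notation f := residual_cost.
Local Notation bordered_mx := (bordered_mx h).

Lemma dot_row0l (u : 'rV[R]_k) (xi : 'rV[R]_(m + k)) :
  dot (row_mx 0 u) xi = dot u (rsubmx xi).
Proof. by rewrite -{1}[xi]hsubmxK dot_row_mx dot0l add0r. Qed.

Lemma residual_costD x xi :
  f (x + xi) = f x + 2 * dot (W x) (rsubmx xi) + norm2 (rsubmx xi) ^+ 2.
Proof.
rewrite /residual_cost linearD/= addrAC !sqr_norm2.
by move: (W x) (rsubmx xi) => w e; rewrite dotDl !dotDr (dotC e); ring.
Qed.

Lemma dot_delta n (u : 'rV[R]_n) i : dot u (delta_mx 0 i) = u 0 i.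
Proof.
rewrite /dot (bigD1 i)//= mxE !eqxx mulr1 big1 ?addr0// => j ji.
by rewrite mxE (negPf ji) andbF mulr0.
Qed.

Lemma euclidean_gradientE x :
  euclidean_gradient f x = row_mx 0 (2 *: W x).
Proof.
apply/rowP => i; rewrite mxE.
apply: (@derive_quadratic_error _ _ _ _ _ _ _
  (norm2 (rsubmx (delta_mx 0 i : 'rV[R]_(m + k))) ^+ 2) 1) => // t _.
have -> : row_mx 0 (2 *: W x) 0 i =
    dot (row_mx 0 (2 *: W x)) (delta_mx 0 i).
  by rewrite dot_delta.
rewrite residual_costD dot_row0l linearZ/= dotZr dotZl norm2Z exprMn.
rewrite real_normK ?num_real//.
rewrite [X in `|X|](_ : _ = norm2 (rsubmx (delta_mx 0 i)) ^+ 2 * t ^+ 2).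
  by rewrite ger0_norm// mulr_ge0// sqr_ge0.
by rewrite /GRing.scale/=; ring.
Qed.

Lemma rgradE x :
  rgrad h f x = row_mx 0 (2 *: W x) *m ker_proj ('J h x).
Proof. by rewrite /rgrad euclidean_gradientE tangent_projE. Qed.

Lemma dot_rgrad x xi : xi *m 'J h x = 0 ->
  dot (rgrad h f x) xi = 2 * dot (W x) (rsubmx xi).
Proof.
by move=> xiT; rewrite rgradE dot_ker_proj ker_proj_id// dot_row0l dotZl.
Qed.

Section Direction.
Variables x xi : 'rV[R]_(m + k).
Hypotheses (xiT : xi *m 'J h x = 0) (xiW : rsubmx x + rsubmx xi = wb).

Lemma newton_rsubmx : rsubmx xi = - W x.
Proof. by rewrite -xiW opprB addrAC subrr add0r. Qed.

Lemma residualD t : W (x + t *: xi) = (1 - t) *: W x.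
Proof.
rewrite linearD linearZ/= newton_rsubmx addrAC scalerBl scale1r.
by rewrite scalerN.
Qed.

Lemma dot_rgrad_newton : dot (rgrad h f x) xi = - (2 * f x).
Proof.
by rewrite dot_rgrad// newton_rsubmx dotC dotNl /residual_cost sqr_norm2 mulrN.
Qed.

(** The residual, hence the gradient, vanishes on the whole line through [x], whatever the rank of
    the Jacobian. *)
Lemma rhess_eq0 : W x = 0 -> rgrad h f x = 0 /\ rhess h f x xi = 0.
Proof.
move=> Wx; have g0 t : rgrad h f (x + t *: xi) = 0.
  by rewrite rgradE residualD Wx !scaler0 row_mx0 mul0mx.
have r0 : rgrad h f x = 0 by rewrite -(g0 0) scale0r addr0.
split=> //; rewrite /rhess (@derive_quadratic_error _ _ _ _ _ _ 0 0 1)//.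
  by rewrite tangent_projE mul0mx.
by move=> t _; rewrite g0 r0 scaler0 !subr0 normr0 mul0r.
Qed.
End Direction.

(** With [c] the defect [grad + hess xi], take [E z = - (<z, xi> / |xi|^2) c]: it sends [xi] to
    [- c], has norm at most [|c| / |xi|] by Cauchy-Schwarz, and takes tangent values because [c] is
    a sum of projected vectors. *)
Lemma approximate_newton_directionP gamma x xi :
  0 <= gamma -> xi *m 'J h x = 0 ->
  norm2 (rgrad h f x + rhess h f x xi) <= gamma * norm2 (rgrad h f x) * norm2
    xi ->
  approximate_newton_direction h f gamma x xi.
Proof.
move=> gamma0 xiT; set c := _ + _ => c_le.
pose M := (dot xi xi)^-1 *: (xi^T *m - c).
have zM z : z *m M = ((dot xi xi)^-1 * dot z xi) *: - c.
  rewrite /M -scalemxAr mulmxA [z *m _]mx11_scalar mul_scalar_mx -dotE.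
  by rewrite scalerA.
have cT : tangent_space h x c.
  apply/(tangent_quadratic hE); rewrite mulmxDl rgradE /rhess.
  by rewrite tangent_projE -!mulmxA mul_ker_proj !mulmx0 addr0.
exists (mulmxr M); split => /=.
- move=> z _; rewrite zM; apply/(tangent_quadratic hE).
  by rewrite -scalemxAl mulNmx (proj1 (tangent_quadratic hE _ _) cT) oppr0
    scaler0.
(* For [xi = 0] the operator is zero and the bound itself forces [c = 0]. *)
- rewrite zM; have [xi0|xi0] := eqVneq xi 0.
    have : norm2 c <= 0 by rewrite (le_trans c_le)// xi0 norm20 mulr0.
    rewrite le_eqVlt ltNge norm2_ge0 orbF norm2_eq0 => /eqP c0.
    rewrite c0 oppr0 scaler0 addr0; apply/eqP; rewrite -addr_eq0 addrC.
    exact/eqP.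
  by rewrite mulVf ?dot_eq0// scale1r /c opprD addrCA subrr addr0.
- apply: sup_le_ub; first by exists (norm2 (0 *m M)), 0 => //; split;
  rewrite ?norm20//; apply/(tangent_quadratic hE); rewrite mul0mx.
  move=> _ [z [_ z1] <-] /=; rewrite zM norm2Z norm2N normrM normfV.
  have [xi0|xi0] := eqVneq xi 0.
    by rewrite xi0 dot0l normr0 invr0 !mul0r mulr_ge0// norm2_ge0.
  have n0 : 0 < norm2 xi by rewrite norm2_gt0.
  rewrite (ger0_norm (dot_ge0 xi)) -sqr_norm2 -mulrA ler_pdivrMl ?exprn_gt0//.
  have dz : `|dot z xi| <= norm2 xi.
    rewrite ler_norml -lerN2 opprK -dotNl !(le_trans (cauchy_schwarz _ _))//.
      by rewrite ler_piMl ?norm2_ge0.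
    by rewrite norm2N ler_piMl ?norm2_ge0.
  rewrite (le_trans (ler_pM _ _ dz c_le)) ?norm2_ge0//.
  by rewrite le_eqVlt; apply/orP; left; apply/eqP; ring.
Qed.

Lemma mul_bordered_tr x (z : 'rV[R]_(m + k)) :
  z *m (bordered_mx x)^T = row_mx (z *m 'J h x) (rsubmx z).
Proof.
rewrite bordered_mx.unlock tr_col_mx trmxK tr_row_mx trmx0 trmx1 mul_mx_row.
by rewrite -{2}[z]hsubmxK mul_row_col mulmx0 mulmx1 add0r.
Qed.

Lemma bordered_mxB x y :
  bordered_mx y - bordered_mx x = col_mx (H (y - x))^T 0.
Proof.
have jE : 'J h y = 'J h x + H (y - x).
  by rewrite -(jacobian_quadraticD hE) addrC subrK.
rewrite bordered_mx.unlock jE opp_col_mx add_col_mx subrr; congr (col_mx _ _).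
by apply/matrixP => i j; rewrite !mxE addrAC subrr add0r.
Qed.

(** The left inverse of the Jacobian read off the first columns of the inverse bordered matrix; it
    inherits both the bound and the variation of that inverse. *)
Definition jacobian_linv x := (lsubmx (invmx (bordered_mx x)))^T.

Lemma mul_jacobian_linv x : bordered_mx x \in unitmx ->
  jacobian_linv x *m 'J h x = 1%:M.
Proof.
move=> /mulmxV; rewrite -[invmx _]hsubmxK {1}bordered_mx.unlock.
rewrite mul_col_row scalar_mx_block.
by move=> /eq_block_mx[+ _ _ _] => /(congr1 trmx); rewrite trmx_mul trmxK trmx1.
Qed.

Section Regular.
Variable x : 'rV[R]_(m + k).
Hypothesis x_reg : bordered_mx x \in unitmx.
Local Notation nu := (norm1 (invmx (bordered_mx x))).

(** Stated for arbitrary [z]: tangent vectors give the bound on Newton directions, and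
    [z = x - xstar], which need not be tangent, gives the local error bound. *)
Lemma bordered_ge (z : 'rV[R]_(m + k)) :
  norm2 z <= nu * (norm2 (z *m 'J h x) + norm2 (rsubmx z)).
Proof.
have zE : z = row_mx (z *m 'J h x) (rsubmx z) *m (invmx (bordered_mx x))^T.
  by rewrite -mul_bordered_tr trmx_inv mulmxK// unitmx_tr.
rewrite {1}zE (le_trans (norm2M _ _))// norm1T mulrC ler_wpM2l ?norm1_ge0//.
exact: norm2_row_mx.
Qed.

Lemma newton_solvable : exists xi :
  'rV[R]_(m + k), xi *m 'J h x = 0 /\ rsubmx x + rsubmx xi = wb.
Proof.
pose xi := row_mx 0 (wb - rsubmx x) *m (invmx (bordered_mx x))^T.
exists xi; have := mul_bordered_tr x xi.
rewrite /xi trmx_inv mulmxKV ?unitmx_tr// => /eq_row_mx[<- <-].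
by rewrite addrC subrK.
Qed.

Lemma newton_norm2_le (xi : 'rV[R]_(m + k)) :
  xi *m 'J h x = 0 -> rsubmx x + rsubmx xi = wb ->
  norm2 xi <= nu * norm2 (W x).
Proof.
move=> xiT xiW; rewrite -(norm2N (W x)) -(newton_rsubmx xiW).
by have := bordered_ge xi; rewrite xiT norm20 add0r.
Qed.

(** Test the gradient against the Newton direction: [2 |W|^2 = - <grad, xi> <= |grad| |xi| <= |grad|
    nu |W|], then divide by [|W|]. *)
Lemma residual_le_rgrad : 2 * norm2 (W x) <= nu * norm2 (rgrad h f x).
Proof.
have [xi [xiT xiW]] := newton_solvable.
have := newton_norm2_le xiT xiW; have := dot_rgrad_newton xiT xiW.
have := cauchy_schwarz (rgrad h f x) (- xi).
rewrite dotC dotNl dotC norm2N => + rE; rewrite rE opprK /residual_cost.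
have [-> _ _|] := eqVneq (norm2 (W x)) 0.
  by rewrite mulr0 mulr_ge0 ?norm1_ge0 ?norm2_ge0.
rewrite norm2_eq0 -norm2_gt0 => W0 h1 h2.
rewrite -(ler_pM2r W0); have := ler_wpM2l (norm2_ge0 (rgrad h f x)) h2; lra.
Qed.

Lemma bordered_near : exists2 e, 0 < e & forall y, norm2 (y - x) < e ->
  bordered_mx y \in unitmx /\ norm1 (invmx (bordered_mx y)) <= 2 * nu.
Proof.
have [C C0 HC] := norm1_linear_bound H.
have d0 : 0 < 2 * (nu * C + 1) by rewrite mulr_gt0// ltr_wpDl//
  mulr_ge0 ?norm1_ge0.
exists (2 * (nu * C + 1))^-1 => [|y]; first by rewrite invr_gt0.
rewrite -div1r ltr_pdivlMr// => y_near.
apply: invmx_perturbation => //;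
  rewrite bordered_mxB norm1_col_mx norm1T norm10 addr0.
have := ler_wpM2l (norm1_ge0 (invmx (bordered_mx x))) (HC (y - x)).
by have := norm2_ge0 (y - x); lra.
Qed.

Variable xi : 'rV[R]_(m + k).
Local Notation Y t := (x + t *: xi).

Lemma line_near e : 0 < e ->
  exists2 d, 0 < d & forall t, `|t| < d -> norm2 (Y t - x) < e.
Proof.
move=> e0; have d0 : 0 < norm2 xi + 1 by rewrite ltr_wpDl ?norm2_ge0.
exists (e / (norm2 xi + 1)) => [|t]; first by rewrite divr_gt0.
rewrite ltr_pdivlMr// addrAC subrr add0r norm2Z mulrDr mulr1.
by apply: le_lt_trans; rewrite lerDl.
Qed.

Lemma bordered_line : exists2 d, 0 < d &
  forall t, `|t| < d -> bordered_mx (Y t) \in unitmx.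
Proof.
have [e e0 he] := bordered_near; have [d d0 hd] := line_near e0.
by exists d => // t /hd/he[].
Qed.

Lemma order_bound_invmx_line :
  order_bound 1 (fun t => invmx (bordered_mx (Y t)) - invmx (bordered_mx x)).
Proof.
have [d d0 hd] := bordered_line.
have inv_bound : order_bound 0 (fun t => invmx (bordered_mx (Y t))).
  have [e e0 he] := bordered_near; have [c c0 hc] := line_near e0.
  exists (2 * nu), c; split; rewrite ?mulr_ge0 ?norm1_ge0// => t /hc/he[_].
  by rewrite mulr1.
apply: (order_bound_eq d0) => [t /hd uy|]; first by rewrite invmxB//.
apply: (order_boundM (k := 1) _ inv_bound).
apply: (order_boundM (l := 1) (order_bound_cst _)).
apply: (@order_bound_eq _ _ _ _ (fun t => - (t *:
  col_mx (H xi)^T 0)) _ 1) => //.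
  move=> t _; rewrite -[RHS]opprB bordered_mxB [Y t]addrC addrK.
  have -> : H (t *: xi) = t *: H xi by exact: linearZ.
  congr (- _); apply/matrixP => i j; rewrite !mxE.
  by case: (fintype.split i) => l; rewrite !mxE ?mulr0.
by apply/order_boundN/order_boundZ/order_bound_cst.
Qed.

Lemma order_bound_linv_line :
  order_bound 1 (fun t => jacobian_linv (Y t) - jacobian_linv x).
Proof.
have := order_boundT (order_bound_lsubmx order_bound_invmx_line).
by apply: (order_bound_eq ltr01) => t _; apply/matrixP => i j; rewrite !mxE.
Qed.

Local Notation P := (ker_proj ('J h x)).
Local Notation P_ t := (ker_proj ('J h (Y t))).
Local Notation X := (jacobian_linv x).
Local Notation X_ t := (jacobian_linv (Y t)).

(** Minus the difference quotient of the projection, obtained from [ker_projB] with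
    [A' - A = t *: H xi]. *)
Let D t := P_ t *m H xi *m X *m (1%:M - P) + (P *m H xi *m X_ t *m (1%:M - P_
  t))^T.

Lemma ker_proj_line : exists2 d, 0 < d & forall t, `|t| < d -> P_ t - P = - (t
  *: D t).
Proof.
have [d d0 hd] := bordered_line; exists d => // t /hd uy.
have jE : 'J h (Y t) - 'J h x = t *: H xi.
  have -> : t *: H xi = H (t *: xi) by rewrite linearZ.
  by rewrite (jacobian_quadraticD hE) addrAC subrr add0r.
rewrite (ker_projB (mul_jacobian_linv x_reg) (mul_jacobian_linv uy)) jE.
rewrite !mulmx4Z /D scalerDr; congr (- (_ + _)).
by move: (P *m _ *m _ *m _) => B; rewrite linearZ.
Qed.

Lemma order_bound_ker_proj : order_bound 0 (fun t => P_ t).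
Proof.
by exists ((m + k)%:R ^+ 2), 1; split=> [|//|t _];
  rewrite ?sqr_ge0// mulr1 norm1_ker_proj.
Qed.

Lemma order_bound_linv : order_bound 0 (fun t => X_ t).
Proof.
apply: (@order_bound_eq _ _ _ _ (fun t => X_ t - X + X) _ 1) => //.
  by move=> t _; rewrite subrK.
apply: order_boundD (order_bound_cst _).
exact: order_boundW order_bound_linv_line.
Qed.

(** Start of a bootstrap: boundedness of the projections and left inverses bounds [D], so the
    projection moves by O(t), and this in turn makes [D t - D0] of order t. *)
Lemma order_bound_D : order_bound 0 D.
Proof.
have bP := order_bound_ker_proj; have bX := order_bound_linv.
apply: order_boundD.
  do 2!apply: (order_boundM (k := 0) (l := 0) _ (order_bound_cst _)).
  exact: (order_boundM (k := 0) bP (order_bound_cst _)).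
apply: order_boundT; apply: (order_boundM (k := 0) (l := 0)).
  exact: (order_boundM (k := 0) (order_bound_cst _) bX).
exact: order_boundD (order_bound_cst _) (order_boundN bP).
Qed.

Lemma order_bound_ker_projB : order_bound 1 (fun t => P_ t - P).
Proof.
have [d d0 hd] := ker_proj_line.
apply: (order_bound_eq d0) => [t /hd ->//|].
exact/order_boundN/order_boundZ/order_bound_D.
Qed.

Let D0 := P *m H xi *m X *m (1%:M - P) + (P *m H xi *m X *m (1%:M - P))^T.

Lemma order_bound_DB : order_bound 1 (fun t => D t - D0).
Proof.
apply: (@order_bound_eq _ _ _ _ (fun t => (P_ t - P) *m (H xi *m X *m (1%:M -
  P)) +
   (P *m H xi *m ((X_ t - X) *m (1%:M - P_ t) - X *m (P_ t - P)))^T) _ 1) => //.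
  by move=> t _; rewrite -projection_derivativeB.
have bPB := order_bound_ker_projB.
apply: order_boundD; first exact:
  (order_boundM (l := 0) bPB (order_bound_cst _)).
apply: order_boundT; apply:
  (order_boundM (k := 0) (l := 1) (order_bound_cst _)).
apply: order_boundD.
  apply: (order_boundM (l := 0) order_bound_linv_line).
  exact: order_boundD (order_bound_cst _) (order_boundN order_bound_ker_proj).
exact/order_boundN/(order_boundM (k := 0) (order_bound_cst _) bPB).
Qed.

Hypotheses (xiT : xi *m 'J h x = 0) (xiW : rsubmx x + rsubmx xi = wb).
Local Notation g := (row_mx 0 (2 *: W x) : 'rV[R]_(m + k)).

(** Product rule for [(1 - t) g] times the moving projection: the scaling contributes [- grad], the
    projection [- g *m D0]. *)
Lemma derive_rgrad :
  'D_xi (rgrad h f) x = - (g *m D0) - rgrad h f x.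
Proof.
have [d d0 hd] := ker_proj_line.
have [C [e [C0 e0 hC]]] : order_bound 2
    (fun t => t *: (g *m (t *: D t - (D t - D0)))).
  apply: order_boundZ; apply:
    (order_boundM (k := 0) (l := 1) (order_bound_cst _)).
  apply: order_boundD; first exact: order_boundZ order_bound_D.
  exact: order_boundN order_bound_DB.
apply: (@derive_quadratic_error _ _ _ _ _ _ _ C (Num.min d e)).
  by rewrite lt_min d0.
move=> t; rewrite lt_min => /andP[td te].
apply: (le_trans (norm_le_norm2 _)); apply: (le_trans (norm2_le_norm1 _)).
have rE : rgrad h f (Y t) = ((1 - t) *: g) *m P_ t.
  rewrite rgradE (residualD xiW) scalerA mulrC -scalerA scale_row_mx scaler0.
  by [].
have errE : rgrad h f (Y t) - rgrad h f x - t *: (- (g *m D0) - rgrad h f x) =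
    t *: (g *m (t *: D t - (D t - D0))).
  by apply: etrans (projection_remainder g D0 (hd t td)); rewrite rE rgradE.
by rewrite errE; have := hC t te; rewrite real_normK ?num_real.
Qed.

Lemma newton_defect_le C : (forall u, norm1 (H u) <= C * norm2 u) ->
  norm2 (rgrad h f x + rhess h f x xi) <=
  2 * C * nu ^+ 2 * norm2 (rgrad h f x) * norm2 xi.
Proof.
move=> HC.
have -> : rgrad h f x + rhess h f x xi =
    - (g *m (1%:M - P) *m (H xi *m X)^T *m P).
  rewrite /rhess tangent_projE derive_rgrad rgradE.
  exact: (projection_defect g (H xi) X (ker_projK _) (ker_proj_tr _)).
rewrite norm2N (le_trans (norm2_ker_proj _ _))// (le_trans (norm2M _ _))//
  norm1T.
(* The triangle inequality bounds the normal part by [2 |g| = 4 |W|], whence the factor 2 after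
   [residual_le_rgrad]. *)
have g_le : norm2 (g *m (1%:M - P)) <= 2 * (nu * norm2 (rgrad h f x)).
  rewrite mulmxBr mulmx1 (le_trans (ler_norm2B _ _))//.
  have := norm2_ker_proj ('J h x) g; rewrite norm2_row0l norm2Z ger0_norm//.
  by have := residual_le_rgrad; lra.
have X_le : norm1 X <= nu by rewrite /jacobian_linv norm1T norm1_lsubmx.
have HX_le : norm1 (H xi *m X) <= C * norm2 xi * nu.
  apply: (le_trans (norm1M _ _)); apply: ler_pM => //; exact: norm1_ge0.
apply: (le_trans (ler_pM (norm2_ge0 _) (norm1_ge0 _) g_le HX_le)).
by rewrite le_eqVlt; apply/orP; left; apply/eqP; ring.
Qed.
End Regular.
End Newton.

(** * The branch flow equations as an exactly quadratic map *)

Section BranchFlowQuadratic.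
Variables (R : realType) (J : nat) (N : network R J).
Implicit Types (x xi z : state R J) (u : flows R J) (j : 'I_J).

Definition stP x j : R := flowP (u_part x) 0 j.
Definition stQ x j : R := flowQ (u_part x) 0 j.
Definition stl x j : R := currents (u_part x) 0 j.
Definition stv x j : R := voltages (u_part x) 0 j.
Definition stp x j : R := lsubmx (w_part x) 0 j.
Definition stq x j : R := rsubmx (w_part x) 0 j.

(** The fixed slack voltage makes [node_v] affine in the state; [parent_v] is its linear part and
    [parent_slack] its constant part. *)
Definition parent_v x j : R :=
  if parent N j is Some k then stv x k else 0.
Definition parent_slack j : R := if parent N j is Some k then 0 else slack_v N.

Lemma node_vE x j : node_v N (voltages (u_part x)) (parent N j) = parent_slack
  j + parent_v x j.
Proof. by rewrite /parent_slack /parent_v; case: parent => [k|] /=;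
  rewrite ?add0r ?addr0. Qed.

Lemma stP_linear a x y j : stP (a *: x + y) j = a * stP x j + stP y j.
Proof. by rewrite /stP !mxE. Qed.

Lemma stQ_linear a x y j : stQ (a *: x + y) j = a * stQ x j + stQ y j.
Proof. by rewrite /stQ !mxE. Qed.

Lemma stl_linear a x y j : stl (a *: x + y) j = a * stl x j + stl y j.
Proof. by rewrite /stl !mxE. Qed.

Lemma stv_linear a x y j : stv (a *: x + y) j = a * stv x j + stv y j.
Proof. by rewrite /stv !mxE. Qed.

Lemma stp_linear a x y j : stp (a *: x + y) j = a * stp x j + stp y j.
Proof. by rewrite /stp !mxE. Qed.

Lemma stq_linear a x y j : stq (a *: x + y) j = a * stq x j + stq y j.
Proof. by rewrite /stq !mxE. Qed.

Definition st_linear := (stP_linear, stQ_linear, stl_linear, stv_linear,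
  stp_linear, stq_linear).

Lemma parent_v_linear a x y j :
  parent_v (a *: x + y) j = a * parent_v x j + parent_v y j.
Proof. by rewrite /parent_v; case: parent => [k|];
  rewrite ?st_linear ?mulr0 ?addr0. Qed.

Lemma balanceR_linear a u u' j :
  balanceR N (a *: u + u') j = a * balanceR N u j + balanceR N u' j.
Proof.
have PE k : flowP (a *: u + u') 0 k = a * flowP u 0 k + flowP u' 0 k by rewrite
  !mxE.
have lE k : currents (a *:
  u + u') 0 k = a * currents u 0 k + currents u' 0 k by rewrite !mxE.
have vE k : voltages (a *:
  u + u') 0 k = a * voltages u 0 k + voltages u' 0 k by rewrite !mxE.
rewrite /balanceR PE lE vE (eq_bigr _ (fun k _ => PE k)) big_split/= -mulr_sumr.
by ring.
Qed.

Lemma balanceI_linear a u u' j :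
  balanceI N (a *: u + u') j = a * balanceI N u j + balanceI N u' j.
Proof.
have QE k : flowQ (a *: u + u') 0 k = a * flowQ u 0 k + flowQ u' 0 k by rewrite
  !mxE.
have lE k : currents (a *:
  u + u') 0 k = a * currents u 0 k + currents u' 0 k by rewrite !mxE.
have vE k : voltages (a *:
  u + u') 0 k = a * voltages u 0 k + voltages u' 0 k by rewrite !mxE.
rewrite /balanceI QE lE vE (eq_bigr _ (fun k _ => QE k)) big_split/= -mulr_sumr.
by ring.
Qed.

Lemma u_part_linear a x y : u_part (a *: x + y) = a *: u_part x + u_part y.
Proof. by rewrite /u_part linearP. Qed.

Definition F_linear x : flows R J :=
  row_mx
    (row_mx (\row_j (balanceR N (u_part x) j - stp x j))
            (\row_j (balanceI N (u_part x) j - stq x j)))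
    (row_mx
      (\row_j (stv x j -
         voltage_drop N (parent_v x j) (stP x j) (stQ x j) (stl x j) j))
      (\row_j (parent_slack j * stl x j))).

(** Only (C) is nonlinear. This is its second derivative: on the diagonal it is twice
    [v_i l - P^2 - Q^2], which explains the factor 1/2 in [F_bfmD]. *)
Definition F_bilinear x y : flows R J :=
  row_mx 0 (row_mx 0
    (\row_j (parent_v x j * stl y j + parent_v y j * stl x j
              - 2 * (stP x j * stP y j + stQ x j * stQ y j)))).

Lemma F_linear_is_linear : linear F_linear.
Proof.
move=> a x y; rewrite /F_linear !scale_row_mx !add_row_mx u_part_linear.
congr (row_mx (row_mx _ _) (row_mx _ _)); apply/rowP => j;
  rewrite [RHS]mxE [X in _ = X + _]mxE !(mxE _ (fun _ => _)).
- by rewrite balanceR_linear stp_linear; ring.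
- by rewrite balanceI_linear stq_linear; ring.
- by rewrite /voltage_drop parent_v_linear !st_linear; ring.
- by rewrite !st_linear; ring.
Qed.

HB.instance Definition _ :=
  GRing.isLinear.Build R (state R J) (flows R J) _ F_linear F_linear_is_linear.

Lemma F_bilinearC x y : F_bilinear x y = F_bilinear y x.
Proof.
by congr (row_mx _ (row_mx _ _)); apply/rowP => j;
  rewrite !(mxE _ (fun _ => _)); ring.
Qed.

Lemma F_bilinear_is_linear x : linear (F_bilinear x).
Proof.
move=> a y z; rewrite /F_bilinear !scale_row_mx !add_row_mx !scaler0 !addr0.
congr (row_mx _ (row_mx _ _)); apply/rowP => j.
rewrite [RHS]mxE [X in _ = X + _]mxE !(mxE _ (fun _ => _)).
by rewrite parent_v_linear !st_linear; ring.
Qed.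

HB.instance Definition _ x :=
  GRing.isLinear.Build R (state R J) (flows R J) _ (F_bilinear x)
    (F_bilinear_is_linear x).

Definition F_hessian x : 'M[R]_(((J + J) + (J + J)) + (J + J), (J + J) + (J +
  J)) :=
  lin1_mx (F_bilinear x).

Lemma mul_F_hessian x y : y *m F_hessian x = F_bilinear x y.
Proof. by rewrite mul_rV_lin1. Qed.

Lemma F_hessian_is_linear : linear F_hessian.
Proof.
move=> a x y; apply/row_matrixP => i;
  rewrite !rowE mulmxDr -scalemxAr !mul_F_hessian.
by rewrite 3!(F_bilinearC _ (delta_mx _ _)) linearP.
Qed.

HB.instance Definition _ :=
  GRing.isLinear.Build R (state R J) 'M[R]_(((J + J) + (J + J)) + (J + J), (J +
    J) + (J + J))
    _ F_hessian F_hessian_is_linear.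

Lemma F_bfmE x : F_bfm N x =
  row_mx
    (row_mx (\row_j (balanceR N (u_part x) j - stp x j))
            (\row_j (balanceI N (u_part x) j - stq x j)))
    (row_mx
      (\row_j (stv x j - voltage_drop N (parent_slack j + parent_v x j)
                           (stP x j) (stQ x j) (stl x j) j))
      (\row_j ((parent_slack j + parent_v x j) * stl x j
               - (stP x j ^+ 2 + stQ x j ^+ 2)))).
Proof.
by congr (row_mx _ (row_mx _ _)); apply/rowP => j;
  rewrite [LHS]mxE node_vE [RHS]mxE.
Qed.

Lemma F_bfmD x xi : F_bfm N (x + xi) =
  F_bfm N x + xi *m (lin1_mx F_linear + F_hessian x) + 2^-1 *:
    (xi *m F_hessian xi).
Proof.
rewrite mulmxDr mul_rV_lin1 !mul_F_hessian !F_bfmE /F_linear /F_bilinear.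
have rE (g : 'I_J -> R) j : (\row_j g j) 0 j = g j by rewrite mxE.
have aE (A B : 'rV[R]_J) j : (A + B) 0 j = A 0 j + B 0 j by rewrite mxE.
have sE a (A : 'rV[R]_J) j : (a *: A) 0 j = a * A 0 j by rewrite mxE.
rewrite !scale_row_mx !scaler0 !add_row_mx !addr0 -[x in x + xi]scale1r
  add_row_mx.
congr (row_mx (row_mx _ _) (row_mx _ _)); apply/rowP => j;
  rewrite !(rE, aE, sE).
- by rewrite u_part_linear balanceR_linear stp_linear; ring.
- by rewrite u_part_linear balanceI_linear stq_linear; ring.
- by rewrite /voltage_drop parent_v_linear !st_linear; ring.
- by rewrite parent_v_linear !st_linear; field.
Qed.
End BranchFlowQuadratic.

Section FiniteBounds.
Context {R : realType}.

Lemma uniform_bounds n (Q : 'I_n -> R -> R -> Prop) :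
  (forall j C C' e e', C <= C' -> 0 < e' -> e' <= e -> Q j C e -> Q j C' e') ->
  (forall j, exists C e, [/\ 0 <= C, 0 < e & Q j C e]) ->
  exists C e, [/\ 0 <= C, 0 < e & forall j, Q j C e].
Proof.
move=> Qmono /choice[C /choice[e hQ]].
(* The default 1 keeps the minimum positive when there is no index. *)
have e0 : 0 < \big[Num.min/1]_j e j.
  elim/big_ind: _ => //; first by move=> a b; rewrite lt_min => -> ->.
  by move=> j _; case: (hQ j).
exists (\sum_j C j), (\big[Num.min/1]_j e j); split=> // [|j].
  by apply: sumr_ge0 => j _; case: (hQ j).
have [_ _] := hQ j; apply: Qmono => //; last exact: bigmin_le.
by rewrite (bigD1 j)//= lerDl sumr_ge0// => i _; case: (hQ i).
Qed.
End FiniteBounds.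

(** * The retraction and its second-order accuracy *)

Section BranchFlowRetraction.
Variables (R : realType) (J : nat) (N : network R J).
Implicit Types (x xi z : state R J) (u : flows R J) (j : 'I_J).

Lemma newton_systemE x xi : newton_system N x xi <->
  xi *m 'J (F_bfm N) x = 0 /\ rsubmx x + rsubmx xi = wbar N.
Proof. by split=> -[xiT xiW]; split=> //;
  apply/(tangent_quadratic (F_bfmD N)). Qed.

Lemma newton_system_mxE x : newton_system_mx N x = bordered_mx (F_bfm N) x.
Proof. by rewrite bordered_mx.unlock. Qed.

Lemma regular_unitmx x : regular_point N x -> bordered_mx (F_bfm N) x \in
  unitmx.
Proof. by case=> _ _; rewrite newton_system_mxE row_free_unit. Qed.

(** (R), (I) and (V) are affine, so a tangent move preserves them exactly; the whole error sits in
    (C) and is the quadratic form at [xi]. The retraction has only this error to repair. *)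
Lemma tangent_step x xi j : M_bfm N x -> xi *m 'J (F_bfm N) x = 0 ->
  let y := x + xi in
  [/\ balanceR N (u_part y) j = stp y j, balanceI N (u_part y) j = stq y j,
      stv y j = voltage_drop N (node_v N (voltages (u_part y)) (parent N j))
                  (stP y j) (stQ y j) (stl y j) j &
      node_v N (voltages (u_part y)) (parent N j) * stl y j -
        (stP y j ^+ 2 + stQ y j ^+ 2) =
      parent_v N xi j * stl xi j - (stP xi j ^+ 2 + stQ xi j ^+ 2)].
Proof.
move=> xM xiT y; have := quadraticE (F_bfmD N) x xi.
rewrite xM xiT !add0r -/y mul_F_hessian F_bfmE /F_bilinear.
rewrite !scale_row_mx !scaler0 => /eq_row_mx[+ /eq_row_mx[]].
rewrite -[X in _ = X -> _]row_mx0 => /eq_row_mx[].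
move=> /rowP/(_ j) + /rowP/(_ j) + /rowP/(_ j) + /rowP/(_ j).
rewrite !mxE => /eqP; rewrite subr_eq0 => /eqP hR /eqP.
rewrite subr_eq0 => /eqP hI /eqP.
rewrite subr_eq0 => /eqP hV hC; rewrite !node_vE; split => //.
by rewrite hC; field.
Qed.

(** A state satisfying (R) and (I) is a linear function of its flow part, so errors in [u] carry
    over to the whole state. *)
Definition flows_state u : state R J :=
  row_mx u (row_mx (\row_j balanceR N u j) (\row_j balanceI N u j)).

Lemma flows_state_is_linear : linear flows_state.
Proof.
move=> a u v; rewrite /flows_state !scale_row_mx !add_row_mx.
congr (row_mx _ (row_mx _ _)); apply/rowP => j.
  by rewrite [RHS]mxE [X in _ = X + _]mxE !(mxE _ (fun _ => _)) balanceR_linear.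
by rewrite [RHS]mxE [X in _ = X + _]mxE !(mxE _ (fun _ => _)) balanceI_linear.
Qed.

HB.instance Definition _ :=
  GRing.isLinear.Build R (flows R J) (state R J) _ flows_state
    flows_state_is_linear.

Lemma flows_stateK x :
  (forall j, balanceR N (u_part x) j = stp x j /\ balanceI N (u_part x) j = stq
    x j) ->
  flows_state (u_part x) = x.
Proof.
move=> xw; rewrite /flows_state -[RHS]hsubmxK; congr (row_mx _ _).
rewrite -[RHS]hsubmxK; congr (row_mx _ _); apply/rowP => j; rewrite mxE.
  by rewrite (proj1 (xw j)).
by rewrite (proj2 (xw j)).
Qed.

Section RetractionFlows.
Variables x xi : state R J.
Local Notation y := (x + xi).
Local Notation P := (flowP (u_part y)).
Local Notation Q := (flowQ (u_part y)).

Definition retr_voltages := retr_v N P Q.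
Definition retr_currents : 'rV[R]_J := \row_j retr_l N P Q retr_voltages j.
Definition retr_flows : flows R J :=
  row_mx (row_mx P Q) (row_mx retr_currents retr_voltages).

Lemma retractionE : retraction N x xi = flows_state retr_flows.
Proof. by []. Qed.

Lemma retr_flowsE : [/\ flowP retr_flows = P, flowQ retr_flows = Q,
  currents retr_flows = retr_currents & voltages retr_flows = retr_voltages].
Proof.
by rewrite /flowP /flowQ /currents /voltages /retr_flows !(row_mxKl, row_mxKr).
Qed.

Lemma u_part_retraction : u_part (retraction N x xi) = retr_flows.
Proof. by rewrite /u_part row_mxKl. Qed.

Lemma retr_voltagesE j : retr_voltages 0 j =
  voltage_drop N (node_v N retr_voltages (parent N j)) (P 0 j) (Q 0 j)
    (retr_currents 0 j) j.
Proof. by rewrite {1}/retr_voltages retr_vP mxE [retr_currents _ _]mxE. Qed.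

Lemma retraction_definedE :
  retraction_defined N x xi <-> parent_voltages_neq0 N retr_voltages.
Proof. by rewrite /retraction_defined u_part_retraction;
  case: retr_flowsE => _ _ _ ->. Qed.

Lemma retraction_M : retraction_defined N x xi -> M_bfm N (retraction N x xi).
Proof.
move=> /retraction_definedE v_neq0; rewrite /M_bfm /level_manifold /= /F_bfm.
rewrite u_part_retraction; have [-> -> -> ->] := retr_flowsE.
rewrite /w_part retractionE row_mxKr row_mxKl row_mxKr.
rewrite -!row_mx0; congr (row_mx (row_mx _ _) (row_mx _ _)); apply/rowP => j;
  rewrite [LHS]mxE [RHS]mxE.
- by rewrite [X in _ - X]mxE subrr.
- by rewrite [X in _ - X]mxE subrr.
- by rewrite -retr_voltagesE subrr.
- by rewrite /retr_currents mxE /retr_l mulrC divfK ?subrr// v_neq0.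
Qed.
End RetractionFlows.

End BranchFlowRetraction.

Section RetractionError.
Variables (R : realType) (J : nat) (N : network R J).
Implicit Types (x xi z : state R J) (u : flows R J) (j : 'I_J).

Lemma st_norm2 x j : [/\ `|stP x j| <= norm2 x, `|stQ x j| <= norm2 x,
  `|stl x j| <= norm2 x, `|stv x j| <= norm2 x & `|parent_v N x j| <= norm2 x].
Proof.
have vE k : `|stv x k| <= norm2 x by rewrite /stv !mxE coord_le_norm2.
split=> //; rewrite /stP /stQ /stl ?mxE ?coord_le_norm2//.
by rewrite /parent_v; case: parent => // ; rewrite normr0 norm2_ge0.
Qed.

Lemma parent_vB x y j : parent_v N (x - y) j =
  node_v N (voltages (u_part x)) (parent N j) - node_v N (voltages (u_part y))
    (parent N j).
Proof.
by rewrite !node_vE -scaleN1r addrC parent_v_linear; ring.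
Qed.

Lemma stlB x y j : stl (x - y) j = stl x j - stl y j.
Proof. by rewrite -scaleN1r addrC stl_linear; ring. Qed.

(** [V0], [Vt], [V] are the parent voltages at the reference point, at [x + xi] and after
    retraction; [S / V] is the new current and [l] the one at [x + xi]. One has
    [S / V - l = ((Vt - V) l - rho) / V], and [e] is so small that [|V|] keeps at least half of
    [|V0|]. *)
Lemma quotient_error (V0 V Vt l S B C e s rho : R) :
  V0 != 0 -> 0 <= C -> 0 <= s -> s < e -> e <= 1 -> e * (2 + C) <= `|V0| / 2 ->
  `|Vt - V0| <= 2 * e -> `|V - Vt| <= C * s ^+ 2 ->
  `|l| <= B -> Vt * l - S = rho -> `|rho| <= 3 * s ^+ 2 ->
  V != 0 /\ `|S / V - l| <= (C * B + 3) * (2 / `|V0|) * s ^+ 2.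
Proof.
move=> V0n C0 s0 se e1 eV VtV0 VVt lB rhoE rho_le.
have V0p : 0 < `|V0| by rewrite normr_gt0.
have Vlb : `|V0| / 2 <= `|V|.
  have h1 : `|V0| <= `|V0 - V| + `|V|.
    by rewrite -{1}[V0](subrK V) ler_normD.
  have h2 : `|V0 - V| <= `|Vt - V0| + `|V - Vt|.
    have -> : V0 - V = - (Vt - V0) - (V - Vt) by ring.
    by rewrite (le_trans (ler_normB _ _))// normrN.
  have h3 : C * s ^+ 2 <= C * e by rewrite ler_wpM2l//; nra.
  lra.
have Vp : 0 < `|V| by rewrite (lt_le_trans _ Vlb)// divr_gt0.
have Vn : V != 0 by rewrite -normr_gt0.
split=> //; have -> : S / V - l = ((Vt - V) * l - rho) / V.
  by rewrite -rhoE; field.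
rewrite normrM normfV ler_pdivrMr//.
have num_le : `|(Vt - V) * l - rho| <= (C * B + 3) * s ^+ 2.
  rewrite (le_trans (ler_normB _ _))// (mulrDl (C * B)) lerD// normrM.
  by rewrite mulrAC ler_pM// -normrN opprB.
apply: (le_trans num_le).
have CB : 0 <= C * B by rewrite mulr_ge0// (le_trans _ lB).
rewrite [leRHS](_ : _ = (C * B + 3) * s ^+ 2 * (2 / `|V0| * `|V|));
  last by ring.
rewrite ler_peMr ?mulr_ge0 ?sqr_ge0 ?addr_ge0//.
by rewrite mulrAC ler_pdivlMr// mul1r mulrC -ler_pdivrMr.
Qed.

Variable x0 : state R J.
Hypothesis x0_v : parent_voltages_neq0 N (voltages (u_part x0)).

Definition tangent_near e x xi :=
  [/\ M_bfm N x, xi *m 'J (F_bfm N) x = 0, norm2 (x - x0) < e & norm2 xi < e].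

Definition node_bound i C e := forall x xi, tangent_near e x xi ->
  `|node_v N (retr_voltages N x xi) i - node_v N (voltages (u_part (x + xi))) i|
    <= C * norm2 xi ^+ 2.

Definition line_bound j C e := forall x xi, tangent_near e x xi ->
  [/\ node_v N (retr_voltages N x xi) (parent N j) != 0,
      `|retr_currents N x xi 0 j - stl (x + xi) j| <= C * norm2 xi ^+ 2 &
      `|retr_voltages N x xi 0 j - stv (x + xi) j| <= C * norm2 xi ^+ 2].

(** Induction step along a line: the parent voltage error gives the error of the current, and both
    give the error of the voltage at the lower end. *)
Lemma line_bound_step j :
  (exists C e, [/\ 0 <= C, 0 < e & node_bound (parent N j) C e]) ->
  exists C e, [/\ 0 <= C, 0 < e & line_bound j C e].
Proof.
move=> [C [e [C0 e0 hC]]].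
pose V0 := node_v N (voltages (u_part x0)) (parent N j).
have V0n : V0 != 0 by exact: x0_v.
have V0p : 0 < `|V0| by rewrite normr_gt0.
(* [x + xi] lies within [2 * d <= 2] of [x0], so [B] bounds its current. Below, [D] is the current
   error and [K] adds up the two errors with their coefficients in [voltage_drop]. *)
pose B := `|stl x0 j| + 2.
pose D := (C * B + 3) * (2 / `|V0|).
pose K := `|(tap N j ^+ 2)^-1| * C +
  `|tap N j ^+ 2 * (resistance N j ^+ 2 + reactance N j ^+ 2)| * D.
have C2 : 0 < 2 + C by rewrite ltr_wpDr.
have D0 : 0 <= D.
  by rewrite /D /B mulr_ge0 ?addr_ge0 ?mulr_ge0 ?addr_ge0// invr_ge0 ltW.
have K0 : 0 <= K by rewrite addr_ge0// mulr_ge0.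
pose d := Num.min e (Num.min 1 (`|V0| / 2 / (2 + C))).
have d0 : 0 < d by rewrite !lt_min e0 ltr01 !divr_gt0.
have [de d1 dV] : [/\ d <= e, d <= 1 & d * (2 + C) <= `|V0| / 2].
  by rewrite -ler_pdivlMr// /d !ge_min !lexx ?orbT.
exists (D + K), d; split=> // [|x xi [xM xiT x_near xi_small]];
  first exact: addr_ge0.
have /hC : tangent_near e x xi by split=> //;
  [exact: lt_le_trans de|exact: lt_le_trans de].
set V := node_v _ _ _; set Vt := node_v _ _ _ => VVt.
have [_ _ vE CE] := tangent_step j xM xiT.
have xx0 : norm2 (x + xi - x0) <= 2 * d.
  by rewrite addrAC (le_trans (ler_norm2D _ _))//; lra.
have VtV0 : `|Vt - V0| <= 2 * d.
  by rewrite -parent_vB (le_trans _ xx0)//; case: (st_norm2 (x + xi - x0) j).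
have lB : `|stl (x + xi) j| <= B.
  have := st_norm2 (x + xi - x0) j; rewrite stlB => -[_ _ h _ _].
  have := ler_normD (stl (x + xi) j - stl x0 j) (stl x0 j); rewrite subrK /B;
    lra.
have rho_le : `|parent_v N xi j * stl xi j - (stP xi j ^+ 2 + stQ xi j ^+ 2)|
    <= 3 * norm2 xi ^+ 2.
  have [Pb Qb lb _ vb] := st_norm2 xi j.
  rewrite (le_trans (ler_normB _ _))// normrM.
  have sq a : `|a| <= norm2 xi -> `|a ^+ 2| <= norm2 xi ^+ 2.
    by move=> ha; rewrite normrX ler_pXn2r ?nnegrE ?norm2_ge0.
  have := ler_normD (stP xi j ^+ 2) (stQ xi j ^+ 2).
  have := sq _ Pb; have := sq _ Qb.
  have : `|parent_v N xi j| * `|stl xi j| <= norm2 xi ^+ 2 by rewrite expr2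
    ler_pM.
  lra.
have [Vn l_le] := quotient_error V0n C0 (norm2_ge0 xi) xi_small d1 dV VtV0 VVt
  lB CE rho_le.
have s0 := sqr_ge0 (norm2 xi).
have lE : retr_currents N x xi 0 j = (stP (x + xi) j ^+ 2 + stQ (x + xi) j ^+
  2) / V.
  by rewrite mxE.
split=> //.
  by rewrite lE (le_trans l_le)// (mulrDl D) lerDl mulr_ge0.
rewrite retr_voltagesE vE -/V -/Vt.
rewrite [X in `|X|](_ : _ = (tap N j ^+ 2)^-1 * (V - Vt) +
  tap N j ^+ 2 * (resistance N j ^+ 2 + reactance N j ^+ 2) *
  (retr_currents N x xi 0 j - stl (x + xi) j)); last first.
  by rewrite /voltage_drop /stP /stQ; ring.
rewrite (le_trans (ler_normD _ _))//
  2!normrM (mulrDl D) ler_wpDl ?(mulr_ge0 D0 s0)//.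
rewrite /K (mulrDl (_ * C)); by apply: lerD;
  rewrite -[leRHS]mulrA ler_wpM2l// lE.
Qed.

(** Induction on the number of parent steps to the slack node, where the voltage is fixed and the
    error is zero. *)
Lemma node_bound_all i : exists C e, [/\ 0 <= C, 0 < e & node_bound i C e].
Proof.
have [n] : exists n, iter n (obind (parent N)) i = None.
  by case: i => [j|]; [exact: parent_rooted|exists 0%N].
have slack : exists C e, [/\ 0 <= C, 0 < e & node_bound None C e].
  by exists 0, 1; split=> // x xi _; rewrite subrr normr0 mul0r.
elim: n i => [|n IH] [j|] //.
rewrite iterSr /= => /IH/line_bound_step[C [e [C0 e0 hC]]].
by exists C, e; split=> // x xi /hC[].
Qed.

(** The constants are uniform in the base point [x] near [x0], as needed for iterates that move. *)
Lemma retraction_error : exists C e, [/\ 0 <= C, 0 < e & forall x xi,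
  tangent_near e x xi -> retraction_defined N x xi /\
  norm2 (retraction N x xi - (x + xi)) <= C * norm2 xi ^+ 2].
Proof.
have [||C [e [C0 e0 hC]]] := @uniform_bounds _ _ line_bound.
- move=> j C C' e e' CC' e'0 e'e hj x xi [xM xiT xn xin].
  have [] := hj x xi; first by split=> //; exact: lt_le_trans e'e.
  move=> h1 h2 h3; split=> //.
    by rewrite (le_trans h2)// ler_wpM2r ?sqr_ge0.
  by rewrite (le_trans h3)// ler_wpM2r ?sqr_ge0.
- by move=> j; apply/line_bound_step/node_bound_all.
have [K K0 hK] := norm1_linear_bound (flows_state N).
exists (K * (2 * J%:R * C)), e; split=> //; first by rewrite !mulr_ge0.
move=> x xi xxi; have [xM xiT _ _] := xxi.
split; first by apply/retraction_definedE => j; case: (hC j _ _ xxi).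
(* Both points are now images under [flows_state], and their flows P, Q agree, so only currents and
   voltages contribute: hence [2 * J%:R * C]. *)
have -> : x + xi = flows_state N (u_part (x + xi)).
  by rewrite flows_stateK// => j; case: (tangent_step j xM xiT).
rewrite retractionE -linearB/= (le_trans (norm2_le_norm1 _))//.
rewrite (le_trans (hK _))// -mulrA ler_wpM2l//.
have norm_le (d : 'rV[R]_J) : (forall j, `|d 0 j| <= C * norm2 xi ^+ 2) ->
    norm2 d <= J%:R * (C * norm2 xi ^+ 2).
  move=> hd; rewrite (le_trans (norm2_le_norm1 _))// /norm1 big_ord1.
  rewrite mulr_natl -[X in _ *+ X]card_ord -sumr_const.
  exact: ler_sum.
have subE (A B : 'rV[R]_J) j : (A - B) 0 j = A 0 j - B 0 j by rewrite !mxE.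
have uE : u_part (x + xi) = row_mx (row_mx (flowP (u_part (x + xi))) (flowQ
  (u_part (x + xi))))
    (row_mx (currents (u_part (x + xi))) (voltages (u_part (x + xi)))).
  by rewrite !hsubmxK.
rewrite uE /retr_flows !opp_row_mx !add_row_mx !subrr row_mx0 norm2_row0l.
rewrite (le_trans (norm2_row_mx _ _))// -!mulrA mulr_natl mulr2n lerD//
  norm_le// => j.
  by rewrite subE; case: (hC j _ _ xxi).
by rewrite subE; case: (hC j _ _ xxi).
Qed.
End RetractionError.

(** * Constants [gamma] for the branch flow Newton directions *)

Section ApproximateNewton.
Variables (R : realType) (J : nat) (N : network R J).
Implicit Types (x xi : state R J).
Local Notation F := (F_bfm N).
Local Notation f := (f_bfm N).
Local Notation W x := (w_part x - wbar N).
Local Notation nu x := (norm1 (invmx (bordered_mx F x))).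

Lemma approximate_newton_direction_le x xi (g g' : R) : g <= g' ->
  approximate_newton_direction F f g x xi ->
  approximate_newton_direction F f g' x xi.
Proof.
move=> gg' [E [ET EE En]]; exists E; split=> //.
by rewrite (le_trans En)// ler_wpM2r ?norm2_ge0.
Qed.

Lemma dot_grad_newton x xi : newton_system N x xi ->
  dot (grad_bfm N x) xi = - (2 * f x).
Proof. by move=> /newton_systemE[]; exact: (dot_rgrad_newton (h := F)). Qed.

Lemma f_bfm_eq0 x : (f x == 0) = (w_part x == wbar N).
Proof. by rewrite /f_bfm sqrf_eq0 norm2_eq0 subr_eq0. Qed.

Lemma f_bfm_ge0 x : 0 <= f x.
Proof. by rewrite /f_bfm sqr_ge0. Qed.

(** Away from solutions [<grad, xi> = - 2 f] is nonzero, so neither factor vanishes and [gamma] can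
    be taken as the quotient of the defect by [|grad| |xi|], with no information on the
    derivative. *)
Lemma newton_direction_approximate x xi : newton_system N x xi ->
  exists2 gamma, 0 <= gamma & approximate_newton_direction F f gamma x xi.
Proof.
move=> xi_newton; have [xiT xiW] := (newton_systemE N x xi).1 xi_newton.
have [Wx|Wx] := eqVneq (W x) 0.
  exists 0 => //; apply: (approximate_newton_directionP (F_bfmD N)) => //.
  by have [-> ->] := rhess_eq0 F xiW Wx; rewrite addr0 norm20 !mul0r.
have f_gt0 : 0 < f x by rewrite lt_neqAle eq_sym f_bfm_eq0 -subr_eq0 Wx
  f_bfm_ge0.
have dE := dot_grad_newton xi_newton.
have g0 : 0 < norm2 (grad_bfm N x).
  by rewrite norm2_gt0; apply/eqP => g0; move: dE; rewrite g0 dot0l; lra.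
have xi0 : 0 < norm2 xi.
  by rewrite norm2_gt0; apply/eqP => xi0; move: dE; rewrite xi0 dotC dot0l; lra.
pose c := norm2 (grad_bfm N x + rhess F f x xi).
exists (c / (norm2 (grad_bfm N x) * norm2 xi)).
  by rewrite divr_ge0 ?norm2_ge0// mulr_ge0 ?norm2_ge0.
apply: (approximate_newton_directionP (F_bfmD N)) => //.
  by rewrite divr_ge0 ?norm2_ge0// mulr_ge0 ?norm2_ge0.
by rewrite -mulrA divfK// mulf_neq0// gt_eqF.
Qed.

Lemma regular_direction_approximate : exists2 C, 0 <= C & forall x xi,
  bordered_mx F x \in unitmx -> newton_system N x xi ->
  approximate_newton_direction F f (C * nu x ^+ 2) x xi.
Proof.
have [C C0 HC] := norm1_linear_bound (F_hessian N).
exists (2 * C) => [|x xi x_reg /newton_systemE[xiT xiW]]; first exact: mulr_ge0.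
apply: (approximate_newton_directionP (F_bfmD N)) => //.
  by rewrite mulr_ge0 ?sqr_ge0// mulr_ge0.
exact: (newton_defect_le (F_bfmD N) x_reg xiW HC).
Qed.

(** The norm of the inverse is locally at most twice its value at a point; compactness, used with
    the filter of large bounds [B], yields a common bound. *)
Lemma compact_regular_bound (K : set (state R J)) :
  compact K -> K `<=` regular_point N ->
  exists2 B, 0 <= B & forall x, K x -> nu x <= B.
Proof.
move=> /compact_near_coveringP Kc Kreg.
have := Kc R +oo%R (fun B x => nu x <= B) _.
case=> [x Kx|B [_ hB]].
  have [e e0 he] := bordered_near (F_bfmD N) (regular_unitmx (Kreg _ Kx)).
  exists ([set y | nu y <= 2 * nu x], [set B | 2 * nu x <= B]) => /=.
    split; last by exists (2 * nu x); split=> [|B /ltW]; first exact: num_real.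
    by apply: near_norm2P; exists e => // y /he[].
  by move=> [y B]/= [h1 h2]; exact: le_trans h2.
exists (`|B| + 1) => [|x Kx]; first exact: addr_ge0.
by apply: hB Kx; have := ler_norm B; lra.
Qed.
End ApproximateNewton.

(** * The Armijo line search *)

Section LineSearch.
Variables (R : realType) (J : nat) (N : network R J) (alpha beta sigma : R).
Hypotheses (alpha_gt0 : 0 < alpha) (beta_01 : 0 < beta < 1) (sigma_01 :
  0 < sigma < 1).
Implicit Types (x xi : state R J).
Local Notation F := (F_bfm N).
Local Notation f := (f_bfm N).
Local Notation W x := (w_part x - wbar N).
Local Notation step m := (beta ^+ m * alpha).

Lemma step_gt0 m : 0 < step m.
Proof. by case/andP: beta_01 => b0 _; rewrite mulr_gt0 ?exprn_gt0. Qed.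

Lemma step_le_alpha m : step m <= alpha.
Proof.
case/andP: beta_01 => b0 b1.
by rewrite ler_piMl ?(ltW alpha_gt0)// exprn_ile1// ltW.
Qed.

Lemma small_step e : 0 < e -> exists m, step m < e.
Proof.
move=> e0; case/andP: beta_01 => b0 b1.
have : (fun m => beta ^+ m) @ \oo --> (0 : R) by apply: cvg_expr;
  rewrite gtr0_norm.
move/cvgrPdist_lt => /(_ (e / alpha)) []; first exact: divr_gt0.
move=> m _ /(_ m (leqnn m)) /=; rewrite sub0r normrN gtr0_norm ?exprn_gt0//.
by rewrite ltr_pdivlMr//; exists m.
Qed.

Lemma armijoE x xi t : newton_system N x xi ->
  armijo N sigma x xi t <->
  retraction_defined N x (t *: xi) /\
  2 * sigma * t * f x <= f x - f (retraction N x (t *: xi)).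
Proof.
move=> /dot_grad_newton dE; rewrite /armijo dotZr dE.
have -> : - sigma * (t * - (2 * f x)) = 2 * sigma * t * f x by ring.
by [].
Qed.

Lemma bfm_step_exists x xi m : newton_system N x xi ->
  armijo N sigma x xi (step m) -> exists x', bfm_step N alpha beta sigma x xi
    x'.
Proof.
move=> xi_newton hm.
have [|k /asboolP hk kmin] :=
  @ex_minnP (fun m => `[<armijo N sigma x xi (step m)>]).
  by exists m; apply/asboolP.
exists (retraction N x (step k *: xi)); split=> //; exists k;
  split=> // l lk hl.
by move: (kmin l); rewrite leqNgt lk => /(_ (asboolT hl)).
Qed.

Lemma bfm_run_feasible eps n xs xis : bfm_run N alpha beta sigma eps n xs xis ->
  forall k, (k <= n)%N -> M_bfm N (xs k) /\ parent_voltages_neq0 N (voltages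
    (u_part (xs k))).
Proof.
move=> [M0 v0 hrun] [//|k kn].
have [_ [_ [m [[defd _] _ ->]]]] := hrun k kn.
by split=> //; exact: retraction_M.
Qed.

Lemma f_bfm_gt0 x : M_bfm N x -> ~ load_flow N x -> 0 < f x.
Proof.
move=> xM x_lf; rewrite lt_neqAle eq_sym f_bfm_eq0 f_bfm_ge0 andbT.
by apply/eqP => Wx; apply: x_lf.
Qed.

Lemma bfm_step_descent x xi x' :
  bfm_step N alpha beta sigma x xi x' -> 0 < f x ->
  dot (grad_bfm N x) xi < 0 /\ f x' < f x.
Proof.
move=> [xi_newton [m [/(armijoE _ xi_newton)[_ fx'] _ ->]]] fx.
split; first by rewrite dot_grad_newton// oppr_lt0 mulr_gt0.
have : 0 < 2 * sigma * step m * f x.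
  case/andP: sigma_01 => s0 _; apply: mulr_gt0 fx.
  by apply: mulr_gt0 (step_gt0 m); rewrite mulr_gt0.
by lra.
Qed.

Lemma retraction_residual x xi C t : newton_system N x xi -> 0 <= t ->
  norm2 (retraction N x (t *: xi) - (x + t *: xi)) <= C * norm2 (t *:
    xi) ^+ 2 ->
  norm2 (W (retraction N x (t *: xi)) - (1 - t) *:
    W x) <= C * t ^+ 2 * norm2 xi ^+ 2.
Proof.
move=> /newton_systemE[_ xiW] t0; rewrite norm2Z ger0_norm// exprMn mulrA.
apply: le_trans; rewrite -(residualD xiW).
set y := retraction _ _ _; set z := x + _.
have -> : W y - (rsubmx z - wbar N) = rsubmx (y - z).
  have -> : rsubmx (y - z) = rsubmx y - rsubmx z by exact: linearB.
  by rewrite /w_part opprB addrA subrK.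
exact: norm2_rsubmx.
Qed.

(** The residual shrinks by at least the factor [q = 1 - t (1 + sigma) / 2], and [1 - 2 sigma t -
    q^2 = t (1 - sigma) - t^2 ((1 + sigma) / 2)^2], which is nonnegative for [t <= 1 - sigma]. *)
Lemma armijo_accept x xi t E : newton_system N x xi ->
  retraction_defined N x (t *: xi) -> 0 <= t <= 1 - sigma ->
  norm2 (W (retraction N x (t *: xi)) - (1 - t) *: W x) <= E ->
  E <= t * ((1 - sigma) / 2) * norm2 (W x) ->
  armijo N sigma x xi t.
Proof.
move=> xi_newton defd /andP[t0 t1] WE Ele; apply/(armijoE _ xi_newton);
  split=> //.
case/andP: sigma_01 => s0 s1; rewrite /f_bfm.
set w' := W (retraction _ _ _) in WE *.
have w'_le : norm2 w' <= (1 - t + t * ((1 - sigma) / 2)) * norm2 (W x).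
  rewrite -[w'](subrK ((1 - t) *: W x)) (le_trans (ler_norm2D _ _))// norm2Z.
  by rewrite ger0_norm; lra.
have := norm2_ge0 w'; have := norm2_ge0 (W x).
move: (norm2 w') (norm2 (W x)) w'_le => a b a_le b0 a0.
have q0 : 0 <= 1 - t + t * ((1 - sigma) / 2) by nra.
have : a ^+ 2 <= ((1 - t + t * ((1 - sigma) / 2)) * b) ^+ 2.
  by rewrite ler_pXn2r ?nnegrE// mulr_ge0.
rewrite exprMn => a2.
have b2 := sqr_ge0 b.
have q2 : (1 - t + t * ((1 - sigma) / 2)) ^+ 2 <= 1 - 2 * sigma * t.
  have c_le : ((1 + sigma) / 2) ^+ 2 <= 1 by rewrite expr_le1//; lra.
  have := ler_wpM2l (mulr_ge0 t0 t0) c_le; have := ler_wpM2l t0 t1.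
  rewrite -subr_ge0 => h1 h2; rewrite -subr_ge0.
  rewrite [leRHS](_ : _ = t * (1 - sigma) - t * t * ((1 + sigma) / 2) ^+ 2);
    last by field.
  lra.
by have := ler_wpM2r b2 q2; lra.
Qed.
End LineSearch.

Lemma small_scale (R : realType) (A B : R) : 0 <= A -> 0 < B ->
  exists2 e, 0 < e & forall t, 0 <= t -> t <= e -> A * t < B.
Proof.
move=> A0 B0; exists (B / (A + 1)) => [|t t0];
  first by rewrite divr_gt0// ltr_wpDl.
by rewrite ler_pdivlMr ?ltr_wpDl//; nra.
Qed.

Section LineSearchTerminates.
Variables (R : realType) (J : nat) (N : network R J) (alpha beta sigma : R).
Hypotheses (alpha_gt0 : 0 < alpha) (beta_01 : 0 < beta < 1) (sigma_01 :
  0 < sigma < 1).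
Implicit Types (x xi : state R J).
Local Notation F := (F_bfm N).
Local Notation f := (f_bfm N).
Local Notation W x := (w_part x - wbar N).
Local Notation step m := (beta ^+ m * alpha).

(** [retraction_error] is taken around [x] itself. Its error is of order t^2, while [armijo_accept]
    tolerates a positive multiple of t. *)
Lemma line_search_terminates x xi : M_bfm N x ->
  parent_voltages_neq0 N (voltages (u_part x)) -> 0 < f x ->
  newton_system N x xi -> exists x', bfm_step N alpha beta sigma x xi x'.
Proof.
move=> xM xv fx xi_newton; have [xiT _] := (newton_systemE N x xi).1 xi_newton.
have [C [e [C0 e0 hC]]] := retraction_error xv.
have w0 : 0 < norm2 (W x).
  by rewrite norm2_gt0; apply: contraTneq fx => W0;
    rewrite /f_bfm W0 norm20 expr0n ltxx.
have /andP[s0 s1] := sigma_01.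
have [t1 t1_gt0 ht1] := small_scale (norm2_ge0 xi) e0.
have [||t2 t2_gt0 ht2] := @small_scale _ (C * norm2 xi ^+ 2) ((1 - sigma) / 2 *
  norm2 (W x)).
- by rewrite mulr_ge0 ?sqr_ge0.
- by rewrite mulr_gt0// divr_gt0// subr_gt0.
have [|m] := @small_step _ alpha beta alpha_gt0 beta_01 (Num.min (1 - sigma)
  (Num.min t1 t2)).
  by rewrite !lt_min subr_gt0 s1 t1_gt0.
rewrite !lt_min => /and3P[tm1 tm2 tm3];
  have t_gt0 := step_gt0 alpha_gt0 beta_01 m.
apply: (bfm_step_exists (m := m) xi_newton).
move: (step m) tm1 tm2 tm3 t_gt0 => t tm1 /ltW tm2 /ltW tm3 t_gt0.
have [|defd err] := hC x (t *: xi).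
  split; rewrite ?subrr ?norm20// -?scalemxAl ?xiT ?scaler0//.
  by rewrite norm2Z gtr0_norm// mulrC ht1// ltW.
apply: (armijo_accept sigma_01 xi_newton defd _
  (retraction_residual xi_newton (ltW t_gt0) err)); first by rewrite !ltW.
by have := ht2 _ (ltW t_gt0) tm3; nra.
Qed.
End LineSearchTerminates.

(** * Geometry of the manifold near a regular solution *)

Section LocalGeometry.
Variables (R : realType) (J : nat) (N : network R J).
Implicit Types (x xi : state R J).
Local Notation F := (F_bfm N).
Local Notation W x := (w_part x - wbar N).
Variable xstar : state R J.
Hypotheses (xstar_lf : load_flow N xstar) (xstar_reg : regular_point N xstar).

Lemma residual_lipschitz x : norm2 (W x) <= norm2 (x - xstar).
Proof.
have <- : rsubmx (x - xstar) = W x.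
  have -> : rsubmx (x - xstar) = rsubmx x - rsubmx xstar by exact: linearB.
  by rewrite -(proj2 xstar_lf).
exact: norm2_rsubmx.
Qed.

(** For [d = x - xstar] between two points of the manifold, the exact expansion gives
    [d J = - d H d / 2]. In [bordered_ge] this quadratic term is absorbed into the left side once
    [nu C |d| < 1]. *)
Lemma residual_error_bound : exists C e, [/\ 0 <= C, 0 < e & forall x,
  M_bfm N x -> norm2 (x - xstar) < e -> norm2 (x - xstar) <= C * norm2 (W x)].
Proof.
have [C C0 HC] := norm1_linear_bound (F_hessian N).
have := bordered_ge (regular_unitmx xstar_reg).
set nu := norm1 _ => nu_ge; have nu0 : 0 <= nu by exact: norm1_ge0.
have [|e e0 he] := @small_scale _ (nu * C) 1 _ ltr01; first exact: mulr_ge0.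
exists (2 * nu), e; split=> // [|x xM x_near]; first exact: mulr_ge0.
have := quadraticE (F_bfmD N) xstar (x - xstar).
rewrite [xstar + _]addrC subrK xM (proj1 xstar_lf) add0r => /esym/eqP.
rewrite addr_eq0 => /eqP dJ.
have := nu_ge (x - xstar); rewrite dJ norm2N norm2Z.
have -> : rsubmx (x - xstar) = W x.
  have -> : rsubmx (x - xstar) = rsubmx x - rsubmx xstar by exact: linearB.
  by rewrite -(proj2 xstar_lf).
have := norm2M (x - xstar) (F_hessian N (x - xstar)).
have := HC (x - xstar); have := he _ (norm2_ge0 (x - xstar)) (ltW x_near).
rewrite ger0_norm//; have := norm2_ge0 (x - xstar).
move: (norm2 (x - xstar)) => d d0 nuCd Hd dHd d_le.
have : norm2 ((x - xstar) *m F_hessian N (x - xstar)) <= d * (C * d).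
  by rewrite (le_trans dHd)// ler_wpM2l.
move/(ler_wpM2l nu0); have : nu * C * d * d <= 1 * d by rewrite ler_wpM2r// ltW.
lra.
Qed.

Lemma local_geometry : exists rho nu C, [/\ 0 < rho, 0 < nu, 0 <= C &
  forall x, M_bfm N x -> norm2 (x - xstar) < rho ->
  [/\ parent_voltages_neq0 N (voltages (u_part x)),
      bordered_mx F x \in unitmx /\ norm1 (invmx (bordered_mx F x)) <= nu,
      norm2 (x - xstar) <= nu * norm2 (W x) &
      forall xi, xi *m 'J F x = 0 -> norm2 xi < rho ->
        retraction_defined N x xi /\
        norm2 (retraction N x xi - (x + xi)) <= C * norm2 xi ^+ 2]].
Proof.
have [_ v_neq0 _] := xstar_reg.
have [C [e [C0 e0 hC]]] := retraction_error v_neq0.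
have [D [d [D0 d0 hD]]] := residual_error_bound.
have [r r0 hr] := bordered_near (F_bfmD N) (regular_unitmx xstar_reg).
set nu := norm1 _ in hr; have nu0 : 0 <= nu by exact: norm1_ge0.
exists (Num.min e (Num.min d r)), (2 * nu + D + 1), C; split=> //.
- by rewrite !lt_min e0 d0.
- by rewrite ltr_wpDl// addr_ge0// mulr_ge0.
move=> x xM; rewrite !lt_min => /and3P[xe xd xr].
have hR xi : xi *m 'J F x = 0 -> norm2 xi < e ->
    retraction_defined N x xi /\ norm2 (retraction N x xi - (x + xi)) <= C *
      norm2 xi ^+ 2.
  by move=> xiT xie; apply: hC.
split.
(* With [xi = 0] the error bound says that the retraction returns [x], so its definedness is the
   claim on the voltages of [x]. *)
- have [||defd] := hR 0; rewrite ?mul0mx ?norm20//.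
  rewrite expr0n mulr0 addr0 le_eqVlt ltNge norm2_ge0 orbF norm2_eq0 subr_eq0
    => /eqP xE.
  by move: defd; rewrite /retraction_defined xE.
- by have [uy ny] := hr x xr; split=> //; lra.
- rewrite (le_trans (hD x xM xd))// ler_wpM2r ?norm2_ge0//; lra.
- by move=> xi xiT; rewrite !lt_min => /and3P[xie _ _]; exact: hR.
Qed.
End LocalGeometry.

(** Here [w] and [n] are the residual norms before and after. The last hypothesis bounds [n^2] below
    by about [(t - 1)^2 w^2], whose gap to the Armijo bound is
    [t (t - 2 (1 - sigma)) w^2 >= t mu w^2]; for small [w] the cubic error cannot fill it. *)
Lemma armijo_reject_scalar (R : realType) (K w n t mu sigma : R) :
  0 <= K -> 0 < w -> 0 <= n -> 1 < t -> mu <= t - 2 * (1 - sigma) ->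
  2 * K * w < mu -> 2 * sigma * t * w ^+ 2 <= w ^+ 2 - n ^+ 2 ->
  (t - 1) * w <= n + K * w ^+ 2 -> False.
Proof.
move=> K0 w0 n0 t1 tmu Kw hf hn.
have a0 : 0 <= (t - 1) * w by rewrite mulr_ge0 ?subr_ge0 ?ltW.
have b0 : 0 <= K * w ^+ 2 by rewrite mulr_ge0 ?sqr_ge0.
have n2 : ((t - 1) * w) ^+ 2 - 2 * ((t - 1) * w) * (K * w ^+ 2) <= n ^+ 2.
  move: ((t - 1) * w) (K * w ^+ 2) a0 b0 hn => a b a0 b0 hn.
  have [ab|ba] := lerP a b; first by have := sqr_ge0 n; nra.
  have : (a - b) ^+ 2 <= n ^+ 2 by rewrite ler_pXn2r ?nnegrE//; lra.
  by have := sqr_ge0 b; lra.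
have w2 : 0 < w ^+ 2 by rewrite exprn_gt0.
have : t * (t - 2 * (1 - sigma)) * w ^+ 2 <= (t - 1) * (2 * K * w) * w ^+ 2.
  by rewrite -subr_ge0; nra.
rewrite ler_pM2r//; apply/negP; rewrite -ltNge.
apply: (@le_lt_trans _ _ ((t - 1) * mu)).
  by rewrite ler_pM2l ?subr_gt0// ltW.
have mu0 : 0 < mu by rewrite (le_lt_trans _ Kw)// !mulr_ge0// ltW.
apply: (@lt_le_trans _ _ (t * mu)); first by rewrite ltr_pM2r//; lra.
by rewrite ler_wpM2l//; lra.
Qed.

(** * Invariant region, contraction and rate of convergence *)

Section LocalConvergence.
Variables (R : realType) (J : nat) (N : network R J) (alpha beta sigma : R).
Hypotheses (alpha_gt0 : 0 < alpha) (beta_01 : 0 < beta < 1) (sigma_01 :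
  0 < sigma < 1).
Implicit Types (x xi : state R J).
Local Notation F := (F_bfm N).
Local Notation f := (f_bfm N).
Local Notation W x := (w_part x - wbar N).
Local Notation step m := (beta ^+ m * alpha).
Variable xstar : state R J.
Variables rho nu C : R.
Hypotheses (rho_gt0 : 0 < rho) (nu_gt0 : 0 < nu) (C_ge0 : 0 <= C).
Hypothesis geometry : forall x, M_bfm N x -> norm2 (x - xstar) < rho ->
  [/\ parent_voltages_neq0 N (voltages (u_part x)),
      bordered_mx F x \in unitmx /\ norm1 (invmx (bordered_mx F x)) <= nu,
      norm2 (x - xstar) <= nu * norm2 (W x) &
      forall xi, xi *m 'J F x = 0 -> norm2 xi < rho ->
        retraction_defined N x xi /\
        norm2 (retraction N x xi - (x + xi)) <= C * norm2 xi ^+ 2].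

(** The distance to [xstar] may grow in a step, the residual cannot. Within [rho] the distance is at
    most [nu] times the residual, so a small [kappa] keeps the next point within [rho]. *)
Definition attraction_region kappa x :=
  [/\ M_bfm N x, norm2 (x - xstar) < rho & norm2 (W x) <= kappa].

(* While the residual is at most kappa, a stepsize t <= alpha leads to a point
   within rho of xstar, and is accepted if t <= 1 - sigma. *)
Definition small_radius kappa :=
  [/\ 0 < kappa, alpha * nu * kappa < rho, alpha * nu * kappa <= 1,
      (nu + alpha * nu * (1 + C)) * kappa < rho &
      C * nu ^+ 2 * kappa <= (1 - sigma) / 2].

Lemma small_radius_exists : exists kappa, small_radius kappa.
Proof.
have /andP[s0 s1] := sigma_01.
have an : 0 <= alpha * nu by rewrite mulr_ge0 ?ltW.
have [e1 e10 h1] := small_scale an rho_gt0.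
have [e2 e20 h2] := small_scale an ltr01.
have [|e3 e30 h3] := @small_scale _ (nu + alpha * nu * (1 + C)) _ _ rho_gt0.
  by rewrite addr_ge0 ?(ltW nu_gt0)// mulr_ge0// addr_ge0.
have [||e4 e40 h4] := @small_scale _ (C * nu ^+ 2) ((1 - sigma) / 2).
- by rewrite mulr_ge0 ?sqr_ge0.
- by rewrite divr_gt0// subr_gt0.
pose kappa := Num.min e1 (Num.min e2 (Num.min e3 e4)).
have k0 : 0 < kappa by rewrite !lt_min e10 e20 e30.
have [ke1 ke2 ke3 ke4] : [/\ kappa <= e1, kappa <= e2, kappa <= e3 & kappa <=
  e4].
  by rewrite /kappa !ge_min !lexx ?orbT.
exists kappa; split=> //; have k0' := ltW k0.
- exact: h1.
- exact/ltW/h2.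
- exact: h3.
- exact/ltW/h4.
Qed.

Section Region.
Variable kappa : R.
Hypothesis kappa_small : small_radius kappa.
Local Notation region := (attraction_region kappa).

Lemma region_newton x : region x -> exists xi, newton_system N x xi.
Proof.
move=> [xM x_near _]; have [_ [x_reg _] _ _] := geometry xM x_near.
by have [xi [xiT xiW]] := newton_solvable (wbar N) x_reg; exists xi;
  apply/newton_systemE.
Qed.

Lemma region_newton_le x xi : region x -> newton_system N x xi ->
  norm2 xi <= nu * norm2 (W x).
Proof.
move=> [xM x_near _] /newton_systemE[xiT xiW];
  have [_ [x_reg nu_le] _ _] := geometry xM x_near.
rewrite (le_trans (newton_norm2_le x_reg xiT xiW))// ler_wpM2r ?norm2_ge0//.
Qed.

Lemma region_retraction x xi t :
  region x -> newton_system N x xi -> 0 <= t <= alpha ->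
  [/\ retraction_defined N x (t *: xi),
      norm2 (retraction N x (t *: xi) - xstar) < rho &
      norm2 (W (retraction N x (t *: xi)) - (1 - t) *: W x)
        <= C * t ^+ 2 * (nu * norm2 (W x)) ^+ 2].
Proof.
move=> xG xi_newton /andP[t0 t_le].
have [xM x_near w_le] := xG;
  have [xiT _] := (newton_systemE N x xi).1 xi_newton.
have [k0 k1 k2 k3 k4] := kappa_small.
have xi_le := region_newton_le xG xi_newton.
have w0 := norm2_ge0 (W x); have xi0 := norm2_ge0 xi.
have xi_kappa : norm2 xi <= nu * kappa by rewrite (le_trans xi_le)// ler_pM2l.
have txi_le : norm2 (t *: xi) <= alpha * nu * kappa.
  by rewrite norm2Z ger0_norm// -mulrA ler_pM.
have [_ _ x_le hR] := geometry xM x_near.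
have [||defd err] := hR (t *: xi).
- by rewrite -scalemxAl xiT scaler0.
- exact: le_lt_trans k1.
split=> //.
- have := ler_norm2D (retraction N x (t *: xi) - (x + t *: xi)) (t *:
  xi + (x - xstar)).
  have -> : retraction N x (t *: xi) - (x + t *: xi) + (t *: xi + (x - xstar)) =
      retraction N x (t *: xi) - xstar.
    have telescope (a b c d : state R J) : a - (b + c) + (c + (b - d)) = a - d.
      by apply/rowP => i; rewrite !mxE; ring.
    exact: telescope.
  have := ler_norm2D (t *: xi) (x - xstar).
  have : C * norm2 (t *: xi) ^+ 2 <= C * (alpha * nu * kappa).
    rewrite ler_wpM2l// expr2 (le_trans _ txi_le)// ler_piMl ?norm2_ge0//.
    exact: le_trans k2.
  have : nu * norm2 (W x) <= nu * kappa by rewrite ler_pM2l.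
  lra.
- rewrite (le_trans (retraction_residual xi_newton t0 err))//.
  by rewrite ler_wpM2l ?mulr_ge0 ?sqr_ge0// ler_pXn2r ?nnegrE ?mulr_ge0// ltW.
Qed.

Lemma region_accept x xi t : region x -> newton_system N x xi ->
  0 <= t <= alpha -> t <= 1 - sigma -> armijo N sigma x xi t.
Proof.
move=> xG xi_newton t_le t1;
  have [defd _ err] := region_retraction xG xi_newton t_le.
have /andP[t0 _] := t_le; have [_ _ w_le] := xG; have /andP[s0 s1] := sigma_01.
apply: (armijo_accept sigma_01 xi_newton defd _ err); first by rewrite t0.
have [k0 _ _ _ k4] := kappa_small; have w0 := norm2_ge0 (W x).
have c0 : 0 <= C * nu ^+ 2 by rewrite mulr_ge0 ?sqr_ge0.
have h1 : C * nu ^+ 2 * norm2 (W x) <= (1 - sigma) / 2.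
  by rewrite (le_trans _ k4)// ler_wpM2l.
have tw : 0 <= t * norm2 (W x) by rewrite mulr_ge0.
have h2 := ler_wpM2l tw h1.
have h3 : t * (t * norm2 (W x) * (C * nu ^+ 2 * norm2 (W x))) <=
    t * norm2 (W x) * (C * nu ^+ 2 * norm2 (W x)).
  by rewrite ler_piMl//; [exact: mulr_ge0 tw (mulr_ge0 c0 w0)|lra].
have -> : C * t ^+ 2 * (nu * norm2 (W x)) ^+ 2 =
  t * (t * norm2 (W x) * (C * nu ^+ 2 * norm2 (W x))) by ring.
apply: (le_trans h3); apply: (le_trans h2).
by rewrite le_eqVlt; apply/orP; left; apply/eqP; ring.
Qed.

Lemma region_step_exists x : region x ->
  exists xi x', bfm_step N alpha beta sigma x xi x'.
Proof.
move=> xG; have [xi xi_newton] := region_newton xG; exists xi.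
have /andP[s0 s1] := sigma_01.
have [|m /ltW m_le] := @small_step _ alpha beta alpha_gt0 beta_01 (1 - sigma).
  by rewrite subr_gt0.
apply: (bfm_step_exists (m := m) xi_newton); apply: region_accept => //.
by rewrite ltW ?step_gt0// step_le_alpha.
Qed.

(** Either the first trial [alpha] is accepted, or the previous trial was rejected, hence exceeded
    [1 - sigma]. *)
Definition min_step := Num.min alpha (beta * (1 - sigma)).
Definition contraction := 1 - 2 * sigma * min_step.

Lemma contraction_01 : 0 <= contraction < 1.
Proof.
have /andP[s0 s1] := sigma_01; have /andP[b0 b1] := beta_01.
have m0 : 0 < min_step by rewrite lt_min alpha_gt0 mulr_gt0// subr_gt0.
have m1 : min_step <= 1 - sigma.
  by rewrite /min_step ge_min; apply/orP; right;
    rewrite ler_piMl// ?ltW// subr_gt0.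
rewrite /contraction; have := mulr_gt0 s0 m0; have := ler_wpM2l (ltW s0) m1.
(* [4 sigma (1 - sigma) <= 1] gives nonnegativity, since [min_step <= 1 - sigma]. *)
have := sqr_ge0 (2 * sigma - 1); rewrite sqrrB1; lra.
Qed.

Lemma region_step x xi x' : region x -> bfm_step N alpha beta sigma x xi x' ->
  region x' /\ f x' <= contraction * f x.
Proof.
move=> xG [xi_newton [m [hm hmin ->]]].
have t_le : 0 <= step m <= alpha by rewrite ltW ?step_gt0// step_le_alpha.
have [defd x'_near _] := region_retraction xG xi_newton t_le.
have [_ hf] := (armijoE _ _ xi_newton).1 hm.
have /andP[s0 s1] := sigma_01; have /andP[b0 b1] := beta_01.
have t_ge : min_step <= step m.
  rewrite /min_step ge_min; case: m hmin {hm t_le defd x'_near hf} => [|m] hmin.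
    by rewrite expr0 mul1r lexx.
  apply/orP; right; rewrite exprS -mulrA ler_pM2l// ltW// ltNge;
    apply/negP => t_le1.
  apply: (hmin m) => //; apply: region_accept => //.
  by rewrite ltW ?step_gt0// step_le_alpha.
have f0 := f_bfm_ge0 N x.
have f_le : f (retraction N x (step m *: xi)) <= contraction * f x.
  have := ler_wpM2r f0 t_ge; rewrite /contraction.
  move/(ler_wpM2l (ltW s0)); lra.
split=> //; split=> //; first exact: retraction_M.
have [_ _ w_le] := xG; rewrite (le_trans _ w_le)//.
rewrite -(@ler_pXn2r _ 2) ?nnegrE ?norm2_ge0// (le_trans f_le)//.
by rewrite ler_piMl// ltW//; case/andP: contraction_01.
Qed.

(* For a small residual, the stepsizes beta^k alpha above 2 (1 - sigma) are
   rejected and the stepsize 1 is accepted. *)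
Lemma region_unit_step : armijo_selects_unit_step alpha beta sigma ->
  exists2 kappa', 0 < kappa' & forall x xi x', region x -> norm2 (W x) <=
    kappa' ->
    bfm_step N alpha beta sigma x xi x' -> norm2 (W x') <= C * nu ^+ 2 * norm2
      (W x) ^+ 2.
Proof.
move=> [s2 [m0 [step_m0 m0min]]].
have /andP[s0 s1] := sigma_01; have /andP[b0 b1] := beta_01.
have c0 : 0 <= C * nu ^+ 2 by rewrite mulr_ge0 ?sqr_ge0.
have [|e1 e10 h1] := @small_scale _ (C * nu ^+ 2) (1 - 2 * sigma) c0;
  first by lra.
(* The margin of the last trial before the unit step, smallest among the earlier ones; if [m0 = 0]
   nothing is to be rejected and any positive value will do. *)
pose mu := if m0 is m.+1 then step m - 2 * (1 - sigma) else 1.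
have mu0 : 0 < mu.
  by rewrite /mu; case: (m0) m0min => // m hm; rewrite subr_gt0 hm.
pose K := C * alpha ^+ 2 * nu ^+ 2.
have K0 : 0 <= K by apply: mulr_ge0 (sqr_ge0 _); apply: mulr_ge0 (sqr_ge0 _).
have [|e2 e20 h2] := @small_scale _ (2 * K) mu _ mu0; first exact: mulr_ge0.
exists (Num.min e1 e2) => [|x xi x' xG]; first by rewrite lt_min e10.
rewrite le_min => /andP[w1 w2] xx'; have w0 := norm2_ge0 (W x).
(* At zero residual the rejection argument says nothing, but the contraction gives zero residual
   again. *)
have [f0|f_neq0] := eqVneq (f x) 0.
  have [_] := region_step xG xx'; rewrite f0 mulr0 => f'_le.
  have : f x' == 0 by rewrite eq_le f'_le f_bfm_ge0.
  by rewrite f_bfm_eq0 -subr_eq0 => /eqP ->; rewrite norm20 mulr_ge0 ?sqr_ge0.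
have w_gt0 : 0 < norm2 (W x).
  by rewrite norm2_gt0; apply: contraNneq f_neq0 => W0;
    rewrite /f_bfm W0 norm20 expr0n.
have fE : f x = norm2 (W x) ^+ 2 by [].
case: xx' => xi_newton [m [hm hmin ->]].
have m0_le : 0 <= step m0 <= alpha by rewrite ltW ?step_gt0// step_le_alpha.
have m_eq : m = m0; last first.
  have [_ _] := region_retraction xG xi_newton m0_le.
  rewrite m_eq step_m0 subrr scale0r subr0 => err.
  by rewrite (le_trans err)// le_eqVlt; apply/orP; left; apply/eqP; ring.
case: (ltngtP m m0) => // mm0.
- exfalso.
  have t_le : 0 <= step m <= alpha by rewrite ltW ?step_gt0// step_le_alpha.
  have [_ hf] := (armijoE _ _ xi_newton).1 hm.
  have [_ _ err] := region_retraction xG xi_newton t_le.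
  have t_mu : mu <= step m - 2 * (1 - sigma).
    rewrite /mu; case: (m0) mm0 => // n mn;
      rewrite lerD2r ler_wpM2r ?(ltW alpha_gt0)//.
    by rewrite ler_wiXn2l// ltW.
  have t_gt1 : 1 < step m by have := m0min m mm0; lra.
  move: hf err t_mu t_gt1 t_le.
  move: (step m) => t; set w' := W _;
    rewrite fE /f_bfm -/w' => hf err t_mu t1 /andP[t0 ta].
  have w'_ge : (t - 1) * norm2 (W x) <= norm2 w' + C * t ^+ 2 * (nu * norm2 (W
    x)) ^+ 2.
    have := ler_norm2B w' (w' - (1 - t) *: W x).
    by rewrite opprB addrCA subrr addr0 norm2Z ler0_norm; lra.
  have E_le : C * t ^+ 2 * (nu * norm2 (W x)) ^+ 2 <= K * norm2 (W x) ^+ 2.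
    rewrite exprMn mulrA ler_wpM2r ?sqr_ge0// ler_wpM2r ?sqr_ge0// ler_wpM2l//.
    by rewrite ler_pXn2r ?nnegrE// (le_trans t0).
  have Kw := h2 _ w0 w2.
  apply: (armijo_reject_scalar K0 w_gt0 (norm2_ge0 w') t1 t_mu Kw hf).
  by rewrite (le_trans w'_ge)// lerD2l.
(* The unit step would have been accepted earlier: its residual is at most [(1 - 2 * sigma)] times
   the old one, and [(1 - 2 sigma)^2 <= 1 - 2 sigma] because [sigma < 1/2]. *)
- exfalso; apply: (hmin m0 mm0); apply/(armijoE _ _ xi_newton).
  have [defd _ err] := region_retraction xG xi_newton m0_le; split;
    first exact: defd.
  move: err; rewrite step_m0 subrr scale0r subr0 expr1n !mulr1 fE /f_bfm.
  have c_lt := h1 _ w0 w1.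
  move: (norm2 _) (norm2_ge0 (W (retraction N x (1 *: xi)))) => n' n'0 err.
  have n'_le : n' <= (1 - 2 * sigma) * norm2 (W x).
    have := ler_wpM2r w0 (ltW c_lt); apply: le_trans; rewrite (le_trans err)//.
    by rewrite le_eqVlt; apply/orP; left; apply/eqP; ring.
  have s12 : 0 <= 1 - 2 * sigma by lra.
  have : n' ^+ 2 <= ((1 - 2 * sigma) * norm2 (W x)) ^+ 2.
    by rewrite ler_pXn2r ?nnegrE// mulr_ge0.
  rewrite exprMn; have : (1 - 2 * sigma) ^+ 2 * norm2 (W x) ^+ 2 <= (1 - 2 *
    sigma) * norm2 (W x) ^+ 2.
    by rewrite ler_wpM2r ?sqr_ge0// expr2 ler_piMl//; lra.
  lra.
Qed.

Section Run.
Hypothesis xstar_lf : load_flow N xstar.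
Variables xs xis : nat -> state R J.
Hypothesis run : forall n, bfm_run N alpha beta sigma None n xs xis.
Hypothesis xs0_region : region (xs 0%N).

Lemma run_step k : bfm_step N alpha beta sigma (xs k) (xis k) (xs k.+1).
Proof. by have [_ _ /(_ k (ltnSn k))[]] := run k.+1. Qed.

Lemma run_region k : region (xs k).
Proof. by elim: k => // k IH; have [] := region_step IH (run_step k). Qed.

Lemma run_contraction k : f (xs k) <= contraction ^+ k * f (xs 0%N).
Proof.
elim: k => [|k IH]; first by rewrite mul1r.
have [_ f_le] := region_step (run_region k) (run_step k).
rewrite (le_trans f_le)// exprS -mulrA ler_wpM2l//.
by case/andP: contraction_01.
Qed.

(** The squared distance is at most [nu^2 f], and [f] decays geometrically. *)
Lemma run_cvg : xs @ \oo --> xstar.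
Proof.
apply: cvg_norm2P; apply/cvgrPdist_lt => e e0.
have [||q q0 hq] := @small_scale _ (nu ^+ 2 * f (xs 0%N)) (e ^+ 2).
- by rewrite mulr_ge0 ?sqr_ge0// f_bfm_ge0.
- by rewrite exprn_gt0.
have /andP[c0 c1] := contraction_01.
have : (fun k => contraction ^+ k) @ \oo --> (0 : R) by apply: cvg_expr;
  rewrite ger0_norm.
move/cvgrPdist_lt => /(_ q q0); apply: filterS => k.
rewrite !sub0r !normrN !ger0_norm ?norm2_ge0 ?exprn_ge0// => /ltW ck.
have [xM x_near _] := run_region k; have [_ _ x_le _] := geometry xM x_near.
rewrite -(@ltr_pXn2r _ 2) ?nnegrE ?norm2_ge0 ?(ltW e0)//.
apply: (@le_lt_trans _ _ (nu ^+ 2 * f (xs k))).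
  rewrite /f_bfm -exprMn ler_pXn2r ?nnegrE ?norm2_ge0// mulr_ge0 ?norm2_ge0//.
  exact: ltW.
apply: le_lt_trans (hq _ (exprn_ge0 k c0) ck).
by rewrite -mulrA ler_wpM2l ?sqr_ge0// mulrC run_contraction.
Qed.

(** Chain the error bound at the new point, the quadratic residual estimate and the Lipschitz bound
    at the old point: the new distance is at most [D] times the square of the old. *)
Lemma run_superlinear : armijo_selects_unit_step alpha beta sigma ->
  superlinear_convergence xs xstar.
Proof.
move=> unit_step; split; first exact: run_cvg.
have [kappa' k'0 hk'] := region_unit_step unit_step.
have [|no_hit] := pselect (exists k, xs k = xstar); [by left|right].
pose D := nu * (C * nu ^+ 2).
have D0 : 0 <= D by rewrite mulr_ge0 ?(ltW nu_gt0)// mulr_ge0 ?sqr_ge0.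
have dist_cvg e : 0 < e -> \forall k \near \oo, norm2 (xs k - xstar) < e.
  move=> e0; have := run_cvg;
    move/cvgrPdist_lt => /(_ (e / ((J + J + (J + J) + (J + J)).+1)%:R)).
  case=> [|n _ hn]; first by rewrite divr_gt0.
  exists n => // k nk; have := hn k nk; rewrite /= ltr_pdivlMr// distrC => h.
  rewrite (le_lt_trans (norm2_le_norm _))// (le_lt_trans _ h)//
    mulrC ler_wpM2l//.
  by rewrite ler_nat.
apply/cvgrPdist_lt => e e0.
have [d d0 hd] := small_scale D0 e0.
have [n1 _ hn1] := dist_cvg _ k'0; have [n2 _ hn2] := dist_cvg _ d0.
exists (maxn n1 n2) => // k /=; rewrite geq_max => /andP[n1k n2k].
have xk0 : 0 < norm2 (xs k - xstar).
  by rewrite norm2_gt0 subr_eq0; apply/eqP => xk; apply: no_hit; exists k.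
rewrite sub0r normrN ger0_norm ?divr_ge0 ?norm2_ge0// ltr_pdivrMr//.
have [xM x_near _] := run_region k.+1; have [_ _ x_le _] := geometry xM x_near.
have w_le := residual_lipschitz xstar_lf (xs k).
have := hk' _ _ _ (run_region k) _ (run_step k).
move/(_ (ltW (le_lt_trans w_le (hn1 k n1k)))) => w'_le.
rewrite (le_lt_trans x_le)//.
apply: (@le_lt_trans _ _ (nu * (C * nu ^+ 2 * norm2 (xs k - xstar) ^+ 2))).
  rewrite ler_pM2l// (le_trans w'_le)//
    ler_wpM2l ?(mulr_ge0 C_ge0 (sqr_ge0 nu))//.
  by rewrite ler_pXn2r ?nnegrE ?norm2_ge0.
have -> : nu * (C * nu ^+ 2 * norm2 (xs k - xstar) ^+ 2) =
    D * norm2 (xs k - xstar) * norm2 (xs k - xstar) by rewrite /D; ring.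
by rewrite ltr_pM2r// hd ?norm2_ge0// ltW// hn2.
Qed.
End Run.

Lemma run_exists x0 : region x0 -> exists xs xis :
  nat -> state R J, xs 0%N = x0 /\
  forall n, bfm_run N alpha beta sigma None n xs xis.
Proof.
move=> x0G.
(* A step function defined everywhere, with an arbitrary value outside the region, which the
   iterates never leave. *)
have /choice[s hs] : forall x, exists p : state R J * state R J,
    region x -> bfm_step N alpha beta sigma x p.1 p.2.
  move=> x; have [xG|] := pselect (region x); last by exists (0, 0).
  by have [xi [x' xx']] := region_step_exists xG; exists (xi, x').
pose xs n := iter n (fun x => (s x).2) x0.
have xsG n : region (xs n).
  by elim: n => //= n IH; have [] := region_step IH (hs _ IH).
exists xs, (fun n => (s (xs n)).1); split=> // n.
have [xM x_near _] := x0G; have [x_v _ _ _] := geometry xM x_near.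
by split=> // k _; split=> //; exact: hs.
Qed.
End Region.
End LocalConvergence.

Theorem proposition1 (R : realType) (J : nat) (N : network R J)
    (alpha beta sigma : R) (alpha_gt0 : 0 < alpha)
    (beta_01 : 0 < beta < 1) (sigma_01 : 0 < sigma < 1)
    (feasible : exists x : state R J, load_flow N x) :
  [/\ (* approximate Newton method: every finite run *)
      (forall (eps : option R) (n : nat) (xs xis : nat -> state R J),
         bfm_run N alpha beta sigma eps n xs xis ->
         exists gamma : R,
           approximate_newton (F_bfm N) (f_bfm N) gamma n xs xis),
      (* approximate Newton method: one constant for all runs, of any length,
         in a compact set of regular points *)
      (forall K : set (state R J), compact K -> K `<=` regular_point N ->
         exists gamma : R,
           forall (eps : option R) (n : nat) (xs xis : nat -> state R J),
             bfm_run N alpha beta sigma eps n xs xis ->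
             (forall k, (k < n)%N -> K (xs k)) ->
             approximate_newton (F_bfm N) (f_bfm N) gamma n xs xis),
      (* guaranteed descent *)
      (forall (eps : option R) (n : nat) (xs xis : nat -> state R J),
         bfm_run N alpha beta sigma eps n xs xis ->
         forall k, (k < n)%N -> ~ load_flow N (xs k) ->
           dot (grad_bfm N (xs k)) (xis k) < 0 /\
           f_bfm N (xs k.+1) < f_bfm N (xs k)),
      (* the Armijo line search terminates *)
      (forall (eps : option R) (n : nat) (xs xis : nat -> state R J),
         bfm_run N alpha beta sigma eps n xs xis -> ~ load_flow N (xs n) ->
         forall xi, newton_system N (xs n) xi ->
           exists x', bfm_step N alpha beta sigma (xs n) xi x') &
      (* local superlinear convergence *)
      (forall xstar : state R J, load_flow N xstar -> regular_point N xstar ->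
         exists delta gamma : R,
         [/\ 0 < delta,
             (forall x0 : state R J,
                M_bfm N x0 -> norm2 (x0 - xstar) < delta ->
                exists xs xis : nat -> state R J, xs 0%N = x0 /\
                  forall n, bfm_run N alpha beta sigma None n xs xis) &
             (forall xs xis : nat -> state R J,
                (forall n, bfm_run N alpha beta sigma None n xs xis) ->
                norm2 (xs 0%N - xstar) < delta ->
                [/\ (forall n, approximate_newton (F_bfm N) (f_bfm N) gamma n
                                 xs xis),
                    xs @ \oo --> xstar &
                    armijo_selects_unit_step alpha beta sigma ->
                    superlinear_convergence xs xstar])])].
Proof.
split.
- move=> eps n xs xis run.
  have /choice[g hg] : forall k, exists g, (k < n)%N ->
      0 <= g /\ approximate_newton_direction (F_bfm N) (f_bfm N) g (xs k) (xis
        k).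
    move=> k; have [kn|] := boolP (k < n)%N; last by exists 0.
    have [_ _ /(_ k kn)[_ [xi_newton _]]] := run.
    by have [g g0 hg] := newton_direction_approximate xi_newton; exists g.
  (* The sum of the nonnegative constants of the run dominates each of them. *)
  exists (\sum_(k < n) g k) => k kn; have [g0 hk] := hg k kn.
  apply: approximate_newton_direction_le hk.
  rewrite (bigD1 (Ordinal kn))//= lerDl sumr_ge0// => l _.
  by case: (hg l (ltn_ord l)).
- move=> K Kc Kreg; have [B B0 hB] := compact_regular_bound Kc Kreg.
  have [C C0 hC] := regular_direction_approximate N.
  exists (C * B ^+ 2) => eps n xs xis run xsK k kn.
  have [_ _ /(_ k kn)[_ [xi_newton _]]] := run.
  have xk := xsK k kn.
  apply: approximate_newton_direction_le (hC _ _ (regular_unitmx (Kreg _ xk))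
    xi_newton).
  by rewrite ler_wpM2l// ler_pXn2r ?nnegrE ?norm1_ge0// hB.
- move=> eps n xs xis run k kn xk_lf.
  have [xM _] := bfm_run_feasible run (ltnW kn).
  have [_ _ /(_ k kn)[_ xk_step]] := run.
  exact: (bfm_step_descent alpha_gt0 beta_01 sigma_01 xk_step (f_bfm_gt0 xM
    xk_lf)).
- move=> eps n xs xis run xn_lf xi xi_newton.
  have [xM xv] := bfm_run_feasible run (leqnn n).
  exact: (line_search_terminates alpha_gt0 beta_01 sigma_01 xM xv (f_bfm_gt0 xM
    xn_lf) xi_newton).
- move=> xstar xstar_lf xstar_reg.
  have [rho [nu [C [rho0 nu0 C0 geometry]]]] :=
    local_geometry xstar_lf xstar_reg.
  have [kappa kappa_small] := small_radius_exists alpha_gt0 sigma_01 rho0 nu0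
    C0.
  have [D D0 hD] := regular_direction_approximate N.
  have [kappa0 _ _ _ _] := kappa_small.
  have region0 x : M_bfm N x -> norm2 (x - xstar) < Num.min rho kappa ->
      attraction_region N xstar rho kappa x.
    rewrite lt_min => xM /andP[x_rho x_kappa]; split=> //.
    by rewrite (le_trans (residual_lipschitz xstar_lf x))// ltW.
  exists (Num.min rho kappa), (D * nu ^+ 2); split.
  + by rewrite lt_min rho0.
  + move=> x0 x0M x0_near.
    exact: (run_exists alpha_gt0 beta_01 sigma_01 nu0 C0 geometry kappa_small
      (region0 _ x0M x0_near)).
  + move=> xs xis run xs0_near; have [xs0M _ _] := run 0%N.
    have xs0G := region0 _ xs0M xs0_near.
    split.
    * move=> n k kn.
      have [_ _ /(_ k kn)[_ [xi_newton _]]] := run n.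
      have [xM x_near _] := run_region alpha_gt0 beta_01 sigma_01 nu0 C0
        geometry kappa_small run xs0G k.
      have [_ [x_reg nu_le] _ _] := geometry _ xM x_near.
      apply: approximate_newton_direction_le (hD _ _ x_reg xi_newton).
      by rewrite ler_wpM2l// ler_pXn2r ?nnegrE ?norm1_ge0// ltW.
    * exact: (run_cvg alpha_gt0 beta_01 sigma_01 nu0 C0 geometry kappa_small
      run xs0G).
    * exact: (run_superlinear alpha_gt0 beta_01 sigma_01 nu0 C0 geometry
      kappa_small xstar_lf run xs0G).
Qed.
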